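(* There are constants $C_1,C_2>0$ such that the following hold. (i) If $(\log n)n^{-2/3}\le p\le n^{-1/3}/\log n$, then with high probability $$\chi_c(G_{n,p})\le C_1\cdot\max\left\{\frac{e^{-np^2}np}{\log n},\ \frac{p^{3/2}n}{\sqrt{\log n}}\right\}\cdot\frac{\log n}{\log\Gamma},$$ where $\Gamma:=\max\{e^{-np^2}p^{-1/2}\sqrt{\log n},\ \log n\}$ satisfies $\log\log n\le\log\Gamma=O(\log n)$. (ii) If $\sqrt{(2^{-1}\log n+\log\log n)/n}\le p\le\sqrt{3(\log n)/n}$, then with high probability $$\chi_c(G_{n,p})\le C_2\cdot\frac{p^{3/2}n}{\sqrt{\log n}}\cdot\frac{\log n}{\xi},$$ where $\xi:=2np^2-(\log n+\log\log n)$ satisfies $\log\log n\le\xi<5\log n$.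
   Context: $G_{n,p}$ denotes the binomial random graph on vertex set $[n]$ in which each pair of vertices is an edge independently with probability $p=p(n)$. The clique chromatic number $\chi_c(G)$ is the smallest number of colors in a vertex coloring of $G$ such that no inclusion-maximal clique of $G$ is monochromatic (maximal cliques consisting of a single isolated vertex are ignored). ''With high probability'' means with probability tending to $1$ as $n\to\infty$; $\log$ is the natural logarithm. *)

(* Defs.v *)
From HB Require Import structures.
From mathcomp Require Import all_boot all_order all_algebra.
From mathcomp Require Import all_classical all_reals all_analysis.

Set Implicit Arguments.
Unset Strict Implicit.
Unset Printing Implicit Defensive.

Import Order.TTheory GRing.Theory Num.Theory.
Import numFieldNormedType.Exports.

Local Open Scope ring_scope.

Section SimpleGraph.
Variable V : finType.

Definition pairs : {set {set V}} := [set e : {set V} | #|e| == 2%N].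

Record sgraph := SGraph {
  edges : {set {set V}};
  edges_pairs : edges \subset pairs }.

HB.instance Definition _ := [isSub for edges].
HB.instance Definition _ := [Finite of sgraph by <:].

Implicit Types (G : sgraph) (K : {set V}).

Definition clique G K : bool :=
  [forall x in K, forall y in K, (x != y) ==> ([set x; y] \in edges G)].

Definition monochromatic k (f : {ffun V -> 'I_k}) K : bool :=
  [forall x in K, forall y in K, f x == f y].

(* The condition [1 < #|K|] discards the maximal cliques that consist of one
   isolated vertex (and the empty clique when [V] is empty). *)
Definition clique_coloring G k (f : {ffun V -> 'I_k}) : bool :=
  [forall K : {set V},
     maxset (clique G) K && (1 < #|K|)%N ==> ~~ monochromatic f K].

Definition clique_colorable G k : bool :=
  [exists f : {ffun V -> 'I_k}, clique_coloring G f].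

Lemma clique_colorable_card G : exists k, clique_colorable G k.
Proof.
exists #|V|; apply/existsP; exists [ffun x => enum_rank x].
apply/forallP => K; apply/implyP => /andP[_ /card_gt1P[x [y [Kx Ky xy]]]].
apply/negP => /forall_inP/(_ x Kx)/forall_inP/(_ y Ky).
by rewrite !ffunE (inj_eq enum_rank_inj) (negPf xy).
Qed.

Definition clique_chromatic G : nat := ex_minn (clique_colorable_card G).

End SimpleGraph.

Section RandomGraph.
Variable R : realType.

Definition Gnp_mass n (p : R) (G : sgraph 'I_n) : R :=
  \prod_(e in pairs 'I_n) (if e \in edges G then p else 1 - p).

Definition Gnp_prob n (p : R) (A : pred (sgraph 'I_n)) : R :=
  \sum_(G | A G) Gnp_mass p G.

Local Open Scope classical_set_scope.

Definition whp (p : nat -> R) (A : forall n, pred (sgraph 'I_n)) : Prop :=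
  (fun n => Gnp_prob (p n) (A n)) @ \oo --> (1 : R).

Definition Gamma (p : nat -> R) (n : nat) : R :=
  Num.max (expR (- (n%:R * p n ^+ 2)) * p n `^ (- (1 / 2))
             * Num.sqrt (ln n%:R))
          (ln n%:R).

Definition xi (p : nat -> R) (n : nat) : R :=
  2 * n%:R * p n ^+ 2 - (ln n%:R + ln (ln n%:R)).

End RandomGraph.

(* Main.v *)
(** Vertices are inserted one at a time into color classes, and the edges from the new
    vertex to the earlier ones are exposed only then. A class with at most s vertices
    and O(s^2 p) edges accepts the new vertex without creating a triangle with
    probability at least exp(-O(s^2 p^3)), independently for disjoint classes, so with
    O(n/s) classes some class accepts, up to a superpolynomially small probability.
    A triangle-free class contains no monochromatic maximal clique once every edge
    inside it has a common neighbor.  In range (ii) the edges without a common neighbor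
    form a graph of maximum degree O(log n / xi), which is colored separately.  In
    range (i) the vertices are split into about log n parts with disjoint palettes;
    inside a part the new vertex must also avoid its neighbors with which it has no
    common neighbor outside the part.  The edges leaving the part are exposed first,
    and restricting the common neighbors in this way changes exp(-n p^2) only by a
    constant factor as long as n p^2 = O(log n). *)
Require Import Defs.
From HB Require Import structures.
From mathcomp Require Import all_boot all_order all_algebra.
From mathcomp Require Import all_classical all_reals all_analysis.
From mathcomp Require Import fintype finset ring lra.

Set Implicit Arguments.
Unset Strict Implicit.
Unset Printing Implicit Defensive.

Import Order.TTheory GRing.Theory Num.Theory.
Import numFieldNormedType.Exports.

Local Open Scope ring_scope.

(** Besides closing no triangle, a new vertex must have at most 2sp neighbors in its class, twice
    the mean; this keeps a class of at most s vertices below 2 s^2 p edges. Few neighbors and no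
    triangle are both decreasing events, so Harris's inequality bounds their joint probability by a
    product. The size s is then set by a balance: the number of available classes must beat the
    inverse of the acceptance probability by a factor of order log n. In range (ii) s is of order
    p^(-3/2) sqrt(log n); acceptance has probability at least about n^(-1/16), against n^(1/4)
    classes. In range (i) about s exp(-n p^2) vertices of a class have no common neighbor with the
    new one, and avoiding them costs exp(-O(p s exp(-n p^2))). Taking s of order p^(-3/2) sqrt(log
    n) log Gamma / Gamma turns this cost into a small power of Gamma, which explains the form of
    Gamma. The form of xi comes from n p exp(-n p^2) being exp(-xi/2) up to a constant factor in
    range (ii). *)

(** * Product measures on the subsets of a finite set *)

Section ProductMeasure.
Variables (R : realFieldType) (T : finType) (q : T -> R).

Definition wt (S : {set T}) : R := \prod_e (if e \in S then q e else 1 - q e).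

Definition Ex (h : {set T} -> R) : R := \sum_S wt S * h S.

Definition Pr (A : {set T} -> bool) : R := Ex (fun S => (A S)%:R).

Definition depends (A : {set T}) (U : Type) (h : {set T} -> U) :=
  forall S, h S = h (S :&: A).

(** Distributivity: expanding a product of two-term sums yields one term per subset. The explicit
    probabilities below are all read off this formula by suitable choices of [a] and [b]. *)
Lemma Ex_prod (a b : T -> R) :
  Ex (fun S => \prod_e (if e \in S then a e else b e)) =
  \prod_e (q e * a e + (1 - q e) * b e).
Proof.
rewrite bigA_distr /Ex; apply: eq_bigr => S _.
by rewrite /wt -big_split; apply: eq_bigr => e _; case: ifP.
Qed.

Lemma eq_Ex f g : f =1 g -> Ex f = Ex g.
Proof. by move=> fg; apply: eq_bigr => S _; rewrite fg. Qed.

Lemma Ex_cst c : Ex (fun=> c) = c.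
Proof.
suff E1 : Ex (fun=> 1) = 1.
  rewrite -[RHS]mul1r -[X in X * _]E1 /Ex mulr_suml.
  by apply: eq_bigr => S _; rewrite mulr1.
rewrite -[LHS](@eq_Ex (fun S => \prod_e (if e \in S then 1 else 1))); last first.
  by move=> S; rewrite big1 // => e _; case: ifP.
rewrite Ex_prod big1 // => e _; ring.
Qed.

Lemma ExD f g : Ex (fun S => f S + g S) = Ex f + Ex g.
Proof. by rewrite -big_split; apply: eq_bigr => S _; rewrite mulrDr. Qed.

Lemma ExZ c f : Ex (fun S => c * f S) = c * Ex f.
Proof. by rewrite mulr_sumr; apply: eq_bigr => S _; rewrite mulrCA. Qed.

Lemma Ex_sum (I : Type) (r : seq I) (P : pred I) f :
  Ex (fun S => \sum_(i <- r | P i) f i S) = \sum_(i <- r | P i) Ex (f i).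
Proof.
rewrite exchange_big; apply: eq_bigr => S _; exact: mulr_sumr.
Qed.

Lemma Pr_not A : Pr (fun S => ~~ A S) = 1 - Pr A.
Proof.
rewrite -[X in X - _](Ex_cst 1) -mulN1r -ExZ -ExD; apply: eq_Ex => S.
by case: (A S); rewrite /=; ring.
Qed.

(* Exchanging the coordinates in [A] of two independent samples is an involution
   that preserves the product weight. *)
Lemma Ex_resample A (h : {set T} -> R) :
  Ex h = Ex (fun S2 => Ex (fun S1 => h ((S1 :&: A) :|: (S2 :\: A)))).
Proof.
pose mix (S : {set T} * {set T}) := (S.1 :&: A) :|: (S.2 :\: A).
pose sw S := (mix S, mix (S.2, S.1)).
have swK : involutive sw.
  move=> [S1 S2]; congr pair; apply/setP => e; rewrite !inE /=;
  by case: (e \in A); rewrite ?andbT ?andbF ?orbF.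
have wt_sw S : wt (sw S).1 * wt (sw S).2 = wt S.1 * wt S.2.
  rewrite /wt -!big_split; apply: eq_bigr => e _; rewrite !inE /=.
  by case: (e \in A); rewrite ?andbT ?andbF ?orbF //= mulrC.
transitivity (\sum_S wt S.1 * wt S.2 * h S.1).
  rewrite -(pair_bigA _ (fun S1 S2 => wt S1 * wt S2 * h S1)) /=.
  apply: eq_bigr => S _; rewrite -[LHS]mul1r -[X in X * _](Ex_cst 1) mulr_suml.
  by apply: eq_bigr => S' _; ring.
rewrite (reindex_inj (inv_inj swK)) /=.
under eq_bigr => S _ do rewrite wt_sw.
rewrite -(pair_bigA _ (fun S1 S2 => wt S1 * wt S2 * h (mix (S1, S2)))) /=.
rewrite exchange_big; apply: eq_bigr => S _; rewrite mulr_sumr.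
by apply: eq_bigr => S' _; rewrite /mix /=; ring.
Qed.

Lemma mix_in (A B S1 S2 : {set T}) : B \subset A ->
  ((S1 :&: A) :|: (S2 :\: A)) :&: B = S1 :&: B.
Proof.
move=> /subsetP sBA; apply/setP => e; rewrite !inE.
case: (boolP (e \in B)) => [/sBA->|]; last by rewrite !andbF.
by rewrite !andbT /= orbF.
Qed.

Lemma mix_out (A B S1 S2 : {set T}) : [disjoint A & B] ->
  ((S1 :&: A) :|: (S2 :\: A)) :&: B = S2 :&: B.
Proof.
rewrite disjoint_sym => /disjointFr dAB; apply/setP => e; rewrite !inE.
case: (boolP (e \in B)) => [/dAB->|]; last by rewrite !andbF.
by rewrite !andbT /= andbF.
Qed.

(** After resampling the coordinates in [A], [f] reads only the fresh sample and [g] only the old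
    one, so the double expectation factors. *)
Lemma Ex_indep (A B : {set T}) f g : depends A f -> depends B g -> [disjoint A & B] ->
  Ex (fun S => f S * g S) = Ex f * Ex g.
Proof.
move=> fA gB dAB; rewrite (Ex_resample A) mulrC -ExZ.
rewrite [RHS](_ : _ = Ex (fun S => Ex f * g S)); last first.
  by rewrite !ExZ mulrC.
apply: eq_Ex => S2; rewrite mulrC -ExZ; apply: eq_Ex => S1.
by rewrite fA (mix_in _ _ (subxx A)) -fA gB (mix_out _ _ dAB) -gB mulrC.
Qed.

Lemma depends_sub (A B : {set T}) (U : Type) (h : {set T} -> U) :
  A \subset B -> depends A h -> depends B h.
Proof.
by move=> /setIidPr sAB hA S; rewrite hA [RHS]hA -setIA sAB.
Qed.

Lemma Ex_indep_prod (I : eqType) (r : seq I) (A : I -> {set T}) f :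
    uniq r -> (forall i, depends (A i) (f i)) ->
    {in r &, forall i j, i != j -> [disjoint A i & A j]} ->
  Ex (fun S => \prod_(i <- r) f i S) = \prod_(i <- r) Ex (f i).
Proof.
move=> + fA; elim: r => [|i r IHr] /= => [_ _|/andP[ir ur] dA].
  by rewrite big_nil -[RHS](Ex_cst 1); apply: eq_Ex => S; rewrite big_nil.
rewrite big_cons -IHr //; last first.
  by move=> j k jr kr; apply: dA; rewrite inE ?jr ?kr orbT.
under eq_Ex => S do rewrite big_cons.
apply: (@Ex_indep (A i) (\bigcup_(j <- r) A j)) => //.
  move=> S; apply: eq_big_seq => j jr; apply: (depends_sub _ (fA j)).
  by rewrite (big_rem j) //= subsetUl.
rewrite -setI_eq0 big_distrr /= big_seq big1 // => j jr.
apply/eqP; rewrite setI_eq0; apply: dA; rewrite ?inE ?eqxx ?jr ?orbT //.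
by apply: contraNneq ir => ->.
Qed.

Lemma Pr_subset (B : {set T}) : Pr (fun S => B \subset S) = \prod_(e in B) q e.
Proof.
rewrite [RHS]big_mkcond /=.
rewrite -[LHS](@eq_Ex (fun S => \prod_e (if e \in S then 1 else (e \notin B)%:R))).
  rewrite Ex_prod; apply: eq_bigr => e _; case: (e \in B) => /=; ring.
move=> S; case: (boolP (B \subset S)) => [/subsetP sBS|].
  rewrite big1 // => e _; case: ifPn => // /negP eS.
  by case: (boolP (e \in B)) => // /sBS.
case/subsetPn => e eB /negPf eS; apply/eqP/prodf_eq0; exists e => //.
by rewrite eS eB.
Qed.

Lemma Pr_mem e : Pr (fun S => e \in S) = q e.
Proof.
transitivity (\prod_(i in [set e]) q i); last by rewrite big_set1.
rewrite -Pr_subset.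
by apply: eq_Ex => S; rewrite sub1set.
Qed.

Lemma Pr_disjoint (B : {set T}) : Pr (fun S => [disjoint B & S]) = \prod_(e in B) (1 - q e).
Proof.
rewrite [RHS]big_mkcond /=.
rewrite -[LHS](@eq_Ex (fun S => \prod_e (if e \in S then (e \notin B)%:R else 1))).
  rewrite Ex_prod; apply: eq_bigr => e _; case: (e \in B) => /=; ring.
move=> S; case: (boolP [disjoint B & S]) => [/disjointFl dBS|].
  by rewrite big1 // => e _; case: ifPn => // /dBS->.
rewrite -setI_eq0 => /set0Pn[e]; rewrite inE => /andP[eB eS].
by apply/eqP/prodf_eq0; exists e; rewrite // eS eB.
Qed.

Lemma Ex_split e h :
  Ex h = q e * Ex (fun S => h (e |: S)) + (1 - q e) * Ex (fun S => h (S :\ e)).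
Proof.
rewrite (Ex_resample [set e]) -!ExZ -ExD; apply: eq_Ex => S2.
rewrite -(Pr_mem e) -Pr_not /Pr ![Ex _ * _]mulrC -!ExZ -ExD; apply: eq_Ex => S1.
have -> : S1 :&: [set e] :|: S2 :\ e = if e \in S1 then e |: S2 else S2 :\ e.
  by case: ifP => eS1; apply/setP => y; rewrite !inE; case: eqVneq => [->|];
    rewrite ?eS1 ?andbT ?andbF.
by case: ifP => _ /=; ring.
Qed.

Section Bounded.
Hypothesis q01 : forall e, 0 <= q e <= 1.

Lemma wt_ge0 S : 0 <= wt S.
Proof.
apply: prodr_ge0 => e _; have /andP[q0 q1] := q01 e.
by case: ifP; rewrite ?subr_ge0.
Qed.

Lemma le_Ex f g : (forall S, f S <= g S) -> Ex f <= Ex g.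
Proof. by move=> fg; apply: ler_sum => S _; rewrite ler_wpM2l ?wt_ge0. Qed.

Lemma Ex_ge0 f : (forall S, 0 <= f S) -> 0 <= Ex f.
Proof. by move=> f0; rewrite -(Ex_cst 0); apply: le_Ex. Qed.

Lemma Ex_le_cst c f : (forall S, f S <= c) -> Ex f <= c.
Proof. by move=> fc; rewrite -(Ex_cst c); apply: le_Ex. Qed.

Lemma le_Pr (A B : {set T} -> bool) : (forall S, A S -> B S) -> Pr A <= Pr B.
Proof.
move=> sAB; apply: le_Ex => S.
by rewrite ler_nat; case: (A S) (sAB S) => // ->.
Qed.

Lemma Pr_ge0 A : 0 <= Pr A.
Proof. by apply: Ex_ge0 => S; rewrite ler0n. Qed.

Lemma Pr_exists_le (I : finType) (P : pred I) (A : I -> {set T} -> bool) :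
  Pr (fun S => [exists i, P i && A i S]) <= \sum_(i | P i) Pr (A i).
Proof.
rewrite -Ex_sum; apply: le_Ex => S; case: existsP => [[i /andP[Pi AiS]]|_].
  rewrite (bigD1 i) //= AiS lerDl; apply: sumr_ge0 => j _.
  by rewrite ler0n.
by apply: sumr_ge0 => j _; rewrite ler0n.
Qed.

Lemma Pr_or_le (A B : {set T} -> bool) : Pr (fun S => A S || B S) <= Pr A + Pr B.
Proof.
rewrite -ExD; apply: le_Ex => S.
by case: (A S); case: (B S); rewrite /=; lra.
Qed.

Lemma markov_Ex (f : {set T} -> R) c : 0 < c -> (forall S, 0 <= f S) ->
  Pr (fun S => c <= f S) <= Ex f / c.
Proof.
move=> c0 f0; rewrite mulrC -ExZ; apply: le_Ex => S.
case: (boolP (c <= f S)) => [cf|_]; first by rewrite ler_pdivlMl // mulr1.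
by rewrite mulr_ge0 // invr_ge0 ltW.
Qed.

Definition decreasing_set (f : {set T} -> R) :=
  forall S S' : {set T}, S \subset S' -> f S' <= f S.

(** Induction on the number of coordinates that are read: condition on one coordinate [e], apply the
    induction hypothesis to both restrictions, and combine them by Chebyshev's inequality for a
    two-point distribution. *)
Lemma harris f g : decreasing_set f -> decreasing_set g ->
  Ex f * Ex g <= Ex (fun S => f S * g S).
Proof.
move=> df dg.
suff H A : forall f g, decreasing_set f -> decreasing_set g ->
    Ex (fun S => f (S :&: A)) * Ex (fun S => g (S :&: A)) <=
    Ex (fun S => f (S :&: A) * g (S :&: A)).
  have eT h : Ex (fun S => h (S :&: setT)) = Ex h.
    by apply: eq_Ex => S; rewrite setIT.
  by have := H setT _ _ df dg; rewrite !eT (eT (fun S => f S * g S)).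
elim: {A}#|A| {-2}A (erefl #|A|) => [|k IHk] A cA {}f {}g {}df {}dg.
  have -> : A = set0 by apply/eqP; rewrite -cards_eq0 cA.
  have e0 h : Ex (fun S => h (S :&: set0)) = h set0.
    by rewrite -[RHS]Ex_cst; apply: eq_Ex => S; rewrite setI0.
  by rewrite !e0 (e0 (fun S => f S * g S)).
have /card_gt0P[e eA] : (0 < #|A|)%N by rewrite cA.
have cA' : #|A :\ e| = k by have := cardsD1 e A; rewrite eA cA => -[].
pose h1 (h : {set T} -> R) S := h (e |: S).
have Exh h : Ex (fun S => h (S :&: A)) =
    q e * Ex (fun S => h1 h (S :&: (A :\ e)))
    + (1 - q e) * Ex (fun S => h (S :&: (A :\ e))).
  rewrite (Ex_split e); congr (_ * _ + _ * _); apply: eq_Ex => S; rewrite /h1;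
    congr h; apply/setP => y; rewrite !inE; case: eqVneq => //= ->.
    by rewrite eA.
  by rewrite andbF.
have dh1 h : decreasing_set h -> decreasing_set (h1 h).
  by move=> dh S S' sS; apply: dh; apply: setUS.
rewrite (Exh f) (Exh g) (Exh (fun S => f S * g S)).
have := IHk _ cA' _ _ df dg; have := IHk _ cA' _ _ (dh1 _ df) (dh1 _ dg).
have le1 h : decreasing_set h ->
    Ex (fun S => h1 h (S :&: (A :\ e))) <= Ex (fun S => h (S :&: (A :\ e))).
  by move=> dh; apply: le_Ex => S; apply: dh; apply: subsetU1.
move: (le1 f df) (le1 g dg) (q01 e); rewrite /h1.
set f1 := Ex (fun S => f (e |: _)); set f0 := Ex (fun S => f (_ :&: _)).
set g1 := Ex (fun S => g (e |: _)); set g0 := Ex (fun S => g (_ :&: _)).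
set a1 := Ex (fun S => f (e |: _) * _); set a0 := Ex (fun S => f _ * _).
move: f1 f0 g1 g0 a1 a0 (q e) => f1 f0 g1 g0 a1 a0 t.
move=> lef leg /andP[t0 t1] H1 H0.
(* This is the covariance of the two conditional means; both differences are nonnegative by
   monotonicity. *)
have H2 : 0 <= t * (1 - t) * ((f0 - f1) * (g0 - g1)).
  by rewrite !mulr_ge0 ?subr_ge0.
have H3 : t * (f1 * g1) <= t * a1 by rewrite ler_wpM2l.
have H4 : (1 - t) * (f0 * g0) <= (1 - t) * a0 by rewrite ler_wpM2l ?subr_ge0.
nra.
Qed.

(** Harris's inequality applied once per set of the list. Nonnegativity of [g] is what keeps the
    partial products decreasing. *)
Lemma harris_avoid (I : Type) (r : seq I) (B : I -> {set T}) g :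
    decreasing_set g -> (forall S, 0 <= g S) ->
  (\prod_(i <- r) (1 - \prod_(e in B i) q e)) * Ex g <=
  Ex (fun S => (\prod_(i <- r) (~~ (B i \subset S))%:R) * g S).
Proof.
move=> dg g0; elim: r => [|i r IHr].
  by rewrite big_nil mul1r; under [leRHS]eq_Ex => S do rewrite big_nil mul1r.
under [leRHS]eq_Ex => S do rewrite big_cons -mulrA.
rewrite big_cons -mulrA.
have da j : decreasing_set (fun S => (~~ (B j \subset S))%:R).
  move=> S S' sS; rewrite ler_nat; case: (boolP (B j \subset S)) => //=.
    by move=> /subset_trans/(_ sS) ->.
  by case: (B j \subset S').
have n0 j S : 0 <= (~~ (B j \subset S))%:R :> R by rewrite ler0n.
apply: le_trans (harris (da i) _); last first.
  move=> S S' sS; elim: {IHr} r => [|j r IHr].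
    by rewrite !big_nil !mul1r; apply: dg.
  by rewrite !big_cons -!mulrA ler_pM ?da // mulr_ge0 // prodr_ge0.
rewrite -Pr_subset -Pr_not; apply: ler_wpM2l IHr.
by apply: Pr_ge0.
Qed.

End Bounded.
End ProductMeasure.

(** * Edges from a vertex to a set, and edges inside a set *)

Section Star.
Variable V : finType.
Implicit Types (v x y : V) (C X : {set V}) (S : {set {set V}}).

Definition star v X : {set {set V}} := [set [set v; x] | x in X].

Definition nbr v C S : {set V} := [set x in C | [set v; x] \in S].

(** The restriction to [pairs V] matters: a sampled [S] may contain sets that are not pairs. *)
Definition edges_in S C : {set {set V}} :=
  [set e in pairs V | (e \in S) && (e \subset C)].

Lemma set2_inj v : injective (fun x => [set v; x]).
Proof.
move=> x y /= exy; have : x \in [set v; y] by rewrite -exy set22.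
case/set2P => // xv; have : y \in [set v; x] by rewrite exy set22.
by case/set2P => // ->.
Qed.

Lemma mem_star v X x : ([set v; x] \in star v X) = (x \in X).
Proof. exact: (mem_imset _ _ (@set2_inj v)). Qed.

Lemma star_sub v (X Y : {set V}) : (star v X \subset star v Y) = (X \subset Y).
Proof.
apply/subsetP/subsetP => [sXY x|sXY e /imsetP[x xX ->]].
  by rewrite -!(mem_star v) => /sXY.
by rewrite mem_star sXY.
Qed.

Lemma star_disjoint v (X Y : {set V}) : [disjoint X & Y] -> [disjoint star v X & star v Y].
Proof.
move=> dXY; apply/pred0P => e /=; apply/negP => /andP[/imsetP[x xX ->]].
by rewrite mem_star (disjointFr dXY xX).
Qed.

Lemma star_pairs v X : v \notin X -> star v X \subset pairs V.
Proof.
move=> vX; apply/subsetP => _ /imsetP[x xX ->]; rewrite inE cards2.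
by rewrite (_ : v != x) //; apply: contraNneq vX => ->.
Qed.

Lemma star_disjoint_edges_in v X S : v \notin X ->
  [disjoint star v X & edges_in S X].
Proof.
move=> vX; apply/pred0P => e /=; apply/negP => /andP[/imsetP[x xX ->]].
rewrite inE => /and3P[_ _ /subsetP/(_ v)]; rewrite !inE eqxx => /(_ isT).
exact/negP.
Qed.

Lemma nbr_depends v C : depends (star v C) (nbr v C).
Proof.
move=> S; apply/setP => x; rewrite !inE; case: (boolP (x \in C)) => //= xC.
by rewrite mem_star xC andbT.
Qed.

Lemma edges_in_depends S C (A : {set {set V}}) : edges_in setT C \subset A ->
  edges_in (S :&: A) C = edges_in S C.
Proof.
move=> /subsetP sA; apply/setP => e; rewrite !inE.
have := sA e; rewrite !inE /=; case: (#|e| == 2%N) => //=.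
case: (e \subset C); last by rewrite !andbF.
by move=> /(_ isT) ->; rewrite andbT.
Qed.

End Star.

Lemma prod_bool (R : realFieldType) (I : Type) (r : seq I) (b : I -> bool) :
  \prod_(i <- r) (b i)%:R = (all b r)%:R :> R.
Proof.
elim: r => [|i r IHr]; first by rewrite big_nil.
by rewrite big_cons IHr /=; case: (b i); rewrite ?mul1r ?mul0r.
Qed.

(** * Probability that a vertex can join a class *)

Section EdgeWeight.
Variables (R : realType) (V : finType) (p : R).
Hypothesis p01 : 0 <= p <= 1.
Implicit Types (v : V) (C e : {set V}) (delta : R) (S : {set {set V}}).

(* Random edge sets are sampled among all sets of vertices; the sets that are not
   pairs get probability 0. *)
Definition edge_prob (e : {set V}) : R := if e \in pairs V then p else 0.

Local Notation q := edge_prob.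

Lemma edge_prob01 e : 0 <= q e <= 1.
Proof. by rewrite /q; case: ifP; rewrite ?lexx ?ler01. Qed.

Lemma prod_star v (e : {set V}) : v \notin e -> \prod_(e' in star v e) q e' = p ^+ #|e|.
Proof.
move=> ve; rewrite big_imset /=; last by move=> x y _ _ /set2_inj.
rewrite -prodr_const; apply: eq_bigr => x xe.
rewrite /q (subsetP (star_pairs ve)) // mem_star //.
Qed.

(* [v] may be added to the class [C] if the part of its neighborhood inside [C] is
   small and contains no obstacle of the list [r]. *)
Definition joins (v : V) (C : {set V}) (r : seq {set V}) (delta : R) (S : {set {set V}}) :=
  all (fun e => ~~ (star v e \subset S)) r && (#|nbr v C S|%:R <= delta).

Lemma joins_depends v C r delta : all (fun e : {set V} => e \subset C) r ->
  depends (star v C) (joins v C r delta).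
Proof.
move=> /allP rC S; rewrite /joins -nbr_depends; congr andb.
apply: eq_in_all => e /rC eC.
by rewrite subsetI star_sub eC andbT.
Qed.

Lemma Pr_nbr_le v (C : {set V}) delta : v \notin C -> 0 < delta ->
  1 - #|C|%:R * p / delta <= Pr q (fun S => #|nbr v C S|%:R <= delta).
Proof.
move=> vC delta0.
have -> : #|C|%:R * p = Ex q (fun S => #|nbr v C S|%:R).
  transitivity (\sum_(x in C) Pr q (fun S => [set v; x] \in S)).
    rewrite mulr_natl -sumr_const; apply: eq_bigr => x xC.
    by rewrite Pr_mem /q (subsetP (star_pairs vC)) // mem_star.
  rewrite -Ex_sum; apply: eq_Ex => S.
  rewrite -sum1_card natr_sum big_mkcond [RHS]big_mkcond /=.
  by apply: eq_bigr => x _; rewrite inE; case: (x \in C) => //=; case: ifP.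
rewrite -[leRHS](subKr 1) lerD2l lerN2 -Pr_not.
apply: le_trans (markov_Ex edge_prob01 delta0 _); last by move=> S; rewrite ler0n.
by apply: (le_Pr edge_prob01) => S; rewrite -ltNge; exact: ltW.
Qed.

(** Avoiding the obstacles and having a small degree into [C] are decreasing events, so Harris's
    inequality applies. The factor 1/2 is Markov's inequality for the degree, whose mean is at most
    [delta / 2]. *)
Lemma Pr_joins v C (r : seq {set V}) delta :
    v \notin C -> 0 < delta -> all (fun e : {set V} => e \subset C) r ->
    #|C|%:R * p <= delta / 2 ->
  (\prod_(e <- r) (1 - p ^+ #|e|)) / 2 <= Pr q (joins v C r delta).
Proof.
move=> vC delta0 /allP rC hC.
have -> : \prod_(e <- r) (1 - p ^+ #|e|) =
          \prod_(e <- r) (1 - \prod_(e' in star v e) q e').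
  rewrite big_seq [RHS]big_seq; apply: eq_bigr => e /rC /subsetP eC.
  by rewrite prod_star //; apply: contra vC; exact: eC.
pose g (S : {set {set V}}) : R := (#|nbr v C S|%:R <= delta)%R%:R.
have dg : decreasing_set g.
  move=> S S' sS; rewrite ler_nat.
  suff: (#|nbr v C S'|%:R <= delta) -> (#|nbr v C S|%:R <= delta).
    by do 2!case: (_ <= delta) => //; move=> /(_ isT).
  apply: le_trans; rewrite ler_nat subset_leq_card //.
  by apply/subsetP => x; rewrite !inE => /andP[->] /(subsetP sS).
have g0 S : 0 <= g S by rewrite ler0n.
have := harris_avoid edge_prob01 r (star v) dg g0.
have -> : Ex q (fun S => \prod_(e <- r) (~~ (star v e \subset S))%:R * g S) =
          Pr q (joins v C r delta).
  apply: eq_Ex => S; rewrite prod_bool /joins /g.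
  by case: all; rewrite /= ?mul1r ?mul0r.
apply: le_trans; apply: ler_wpM2l.
  apply: prodr_ge0 => e _; rewrite -Pr_subset -Pr_not.
  exact: (Pr_ge0 edge_prob01).
apply: le_trans (Pr_nbr_le vC delta0).
rewrite lerBrDr addrC -lerBrDr; have -> : 1 - 2^-1 = 2^-1 :> R by lra.
by rewrite ler_pdivrMr // [2^-1 * _]mulrC.
Qed.

End EdgeWeight.

(** Since exp(2y) >= 1 + 2y, it suffices that (1 + 2y)(1 - y) >= 1, which holds exactly between 0
    and 1/2. *)
Lemma expR_le_1subr (R : realType) (y : R) : 0 <= y <= 1 / 2 ->
  expR (- (2 * y)) <= 1 - y.
Proof.
move=> /andP[y0 y2]; rewrite expRN -[leRHS]invrK.
have y1 : 0 < 1 - y by lra.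
rewrite lef_pV2 ?posrE ?invr_gt0 ?expR_gt0 //.
apply: le_trans (expR_ge1Dx _).
rewrite -[leLHS]mul1r ler_pdivrMr //; nra.
Qed.

(** * Counting oversized color classes *)

Section PigeonHole.
Variables (R : realFieldType) (V : finType) (K : nat).

Definition cls (X : {set V}) (f : {ffun V -> 'I_K}) (i : 'I_K) : {set V} :=
  [set x in X | f x == i].

Lemma sum_card_cls X f : \sum_i #|cls X f i| = #|X|.
Proof.
rewrite -sum1_card (partition_big f xpredT) //=; apply: eq_bigr => i _.
by rewrite -sum1_card; apply: eq_bigl => x; rewrite inE.
Qed.

(** The counted classes are disjoint and each has more than [s] elements. It serves both for class
    sizes and for the number of [D]-neighbors in a class. *)
Lemma card_big_cls X f (s : R) :
  s * #|[set i | ~~ (#|cls X f i|%:R <= s)]|%:R <= #|X|%:R.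
Proof.
rewrite -(sum_card_cls X f) natr_sum mulr_natr -sumr_const.
rewrite [leRHS](bigID (mem [set i | ~~ (#|cls X f i|%:R <= s)])) /=.
rewrite -[leLHS]addr0; apply: lerD; last by apply: sumr_ge0.
by apply: ler_sum => i; rewrite inE -ltNge => /ltW.
Qed.

End PigeonHole.

(** * Colorings with sparse triangle-free classes, and their extension by a vertex *)

Section GoodColoring.
Variables (R : realType) (V : finType) (K : nat) (D : rel V) (delta : R).
Hypothesis symD : symmetric D.
Implicit Types (S : {set {set V}}) (X C : {set V}) (f : {ffun V -> 'I_K}).

(* The bound on the number of edges inside a class is what keeps the probability
   that a new vertex closes a triangle away from 1. *)
Record good S X f : Prop := Good {
  good_few_edges : forall i,
    #|edges_in S (cls X f i)|%:R <= delta * #|cls X f i|%:R;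
  good_triangle_free : forall x e, x \in X ->
    e \in edges_in S (cls X f (f x)) -> x \notin e -> ~~ (star x e \subset S);
  good_edge : forall x y, x \in X -> y \in X -> x != y -> f x = f y ->
    [set x; y] \in S -> ~~ D x y }.

Definition colorable_in X S : bool := `[< exists f, good S X f >].

Lemma cls_sub X f i : cls X f i \subset X.
Proof. by apply/subsetP => x; rewrite inE => /andP[]. Qed.

Lemma edges_in_subset S C X : C \subset X -> edges_in S C \subset edges_in S X.
Proof.
move=> sCX; apply/subsetP => e; rewrite !inE => /and3P[-> -> /=].
by move=> /subset_trans; apply.
Qed.

(** Needed for gradual exposure: goodness on [X] is settled before any edge from a new vertex to [X]
    is revealed. *)
Lemma good_depends X f : depends (edges_in setT X) (fun S => good S X f).
Proof.
move=> S; have eqE i : edges_in (S :&: edges_in setT X) (cls X f i)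
    = edges_in S (cls X f i).
  by apply: edges_in_depends; apply: edges_in_subset; exact: cls_sub.
have memE x y : x \in X -> y \in X -> x != y ->
    [set x; y] \in edges_in setT X.
  move=> xX yX xy; rewrite !inE cards2 xy /=.
  by apply/subsetP => z; rewrite !inE => /orP[]/eqP ->.
have starE x (e : {set V}) : x \in X -> e \subset X -> x \notin e ->
    star x e \subset edges_in setT X.
  move=> xX /subsetP eX xe; apply/subsetP => _ /imsetP[y ye ->].
  by apply: memE => //; [exact: eX|apply: contraNneq xe => ->].
have eX i (e : {set V}) : e \in edges_in S (cls X f i) -> e \subset X.
  by rewrite inE => /and3P[_ _ /subset_trans]; apply; exact: cls_sub.
apply/propext; split=> -[H1 H2 H3]; split.
- by move=> i; rewrite eqE.
- move=> x e xX; rewrite eqE => eC xe.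
  by rewrite subsetI negb_and; apply/orP; left; exact: H2.
- by move=> x y xX yX xy fxy; rewrite inE => /andP[xyS _]; exact: H3.
- by move=> i; rewrite -eqE.
- move=> x e xX eC xe; have := H2 x e xX; rewrite eqE => /(_ eC xe).
  by rewrite subsetI negb_and (starE x e) ?(eX _ _ eC) // orbF.
- by move=> x y xX yX xy fxy xyS; apply: H3 => //; rewrite in_setI xyS memE.
Qed.

Lemma colorable_in_depends X : depends (edges_in setT X) (colorable_in X).
Proof.
move=> S; rewrite /colorable_in; congr asbool; congr ex.
apply/funext => f; exact: good_depends.
Qed.

(** A singleton {y} forbids the edge from [v] to a [D]-neighbor [y]; a pair forbids the triangle
    that it spans with [v]. Written this way, both are avoided by the same condition on [star v e],
    and one application of Harris's inequality treats them together. *)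
Definition obstacles S v C : seq {set V} :=
  [seq [set y] | y in C :&: [set y | D v y]] ++ enum (edges_in S C).

Lemma obstacles_sub S v C : all (fun e : {set V} => e \subset C) (obstacles S v C).
Proof.
rewrite all_cat; apply/andP; split; apply/allP => e.
  by move=> /mapP[y]; rewrite mem_enum !inE => /andP[yC _] ->; rewrite sub1set.
by rewrite mem_enum inE => /and3P[].
Qed.

Definition extend f v i : {ffun V -> 'I_K} := [ffun x => if x == v then i else f x].

Lemma cls_extend X f v i j : v \notin X ->
  cls (v |: X) (extend f v i) j = if j == i then v |: cls X f i else cls X f j.
Proof.
move=> vX; apply/setP => x; rewrite !inE ffunE; case: eqVneq => [->|xv] /=.
  case: (eqVneq j i) => [_|ji]; first by rewrite !inE eqxx.
  by rewrite inE (negPf vX).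
by case: (eqVneq j i) => [->|ji]; rewrite ?inE ?(negPf xv) ?inE.
Qed.

Lemma edges_in_setU1 S v C : v \notin C ->
  edges_in S (v |: C) \subset
  edges_in S C :|: [set [set v; x] | x in nbr v C S].
Proof.
move=> vC; apply/subsetP => e; rewrite !inE => /and3P[/cards2P[x [y [xy ->]]]].
move=> eS /subsetP sub.
have := sub x; have := sub y; rewrite !inE !eqxx ?orbT => /(_ isT) + /(_ isT).
case: (eqVneq y v) => [yv _|yv /= yC]; last first.
  case: (eqVneq x v) => [xv _|xv /= xC].
    apply/orP; right; apply/imsetP; exists y; last by rewrite xv.
    by rewrite inE yC -xv.
  apply/orP; left; rewrite cards2 xy eS /=.
  by apply/subsetP => z; rewrite !inE => /orP[]/eqP->.
have {}xy : x != v by rewrite -yv.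
rewrite (negPf xy) /= => xC; apply/orP; right; apply/imsetP; exists x => //.
  by rewrite inE xC -yv setUC.
by rewrite yv setUC.
Qed.

Lemma good_extend S X f v i : v \notin X -> good S X f ->
    joins v (cls X f i) (obstacles S v (cls X f i)) delta S ->
  good S (v |: X) (extend f v i).
Proof.
move=> vX [H1 H2 H3] /andP[/allP hj hd].
set C := cls X f i in hj hd.
have vC : v \notin C by rewrite inE (negPf vX).
have extX x : x \in X -> extend f v i x = f x.
  by move=> xX; rewrite ffunE ifN //; apply: contraNneq vX => <-.
have extv : extend f v i v = i by rewrite ffunE eqxx.
have hF (e : {set V}) : e \in edges_in S C -> ~~ (star v e \subset S).
  by move=> eF; apply: hj; rewrite mem_cat mem_enum eF orbT.
have hD y : y \in C -> D v y -> [set v; y] \notin S.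
  move=> yC Dvy; have := hj [set y]; rewrite mem_cat map_f; last first.
    by rewrite mem_enum in_setI yC inE.
  by move=> /(_ isT); rewrite /star imset_set1 sub1set.
split=> [j|x e|x y].
(* The class gains one vertex and at most [delta] edges, so the linear edge bound survives. *)
- rewrite cls_extend //; case: eqVneq => // _.
  rewrite cardsU1 vC natrD mulrDr mulr1.
  apply: le_trans (_ : (#|edges_in S C| + #|nbr v C S|)%:R <= _).
    rewrite ler_nat; apply: leq_trans (subset_leq_card (edges_in_setU1 _ vC)) _.
    by apply: leq_trans (leq_card_setU _ _) _; rewrite leq_add2l leq_imset_card.
  by rewrite natrD addrC lerD //; exact: H1.
- rewrite cls_extend // in_setU1 => /predU1P[->|xX].
    rewrite extv eqxx => eC ve; apply: hF; move: eC; rewrite !inE.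
    move=> /and3P[-> -> /subsetP sub] /=; apply/subsetP => y ye.
    have := sub y ye; rewrite in_setU1 => /predU1P[yv|//].
    by rewrite -yv ye in ve.
  rewrite extX //; case: eqVneq => [fxi|_]; last exact: H2.
  rewrite -/C => eC xe; case: (boolP (v \in e)) => ve; last first.
    apply: H2 => //; rewrite fxi; move: eC; rewrite !inE.
    move=> /and3P[-> -> /subsetP sub] /=; apply/subsetP => y ye.
    have := sub y ye; rewrite in_setU1 => /predU1P[yv|//].
    by rewrite -yv ye in ve.
  move: eC => /(subsetP (edges_in_setU1 _ vC)); rewrite in_setU => /orP[|].
    by rewrite inE => /and3P[_ _ /subsetP/(_ v ve)]; rewrite (negPf vC).
  (* Here [e] is {v, y}. Seen from [v], the same triangle lies over the edge {x, y} of the old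
     class, which is an obstacle. *)
  move=> /imsetP[y]; rewrite inE => /andP[yC vyS] eE.
  apply/negP => /subsetP sub.
  have yx : x != y by apply: contraNneq xe => ->; rewrite eE set22.
  have xC : x \in C by rewrite inE xX fxi eqxx.
  have xyS : [set x; y] \in S by apply: sub; rewrite mem_star eE set22.
  have xvS : [set x; v] \in S by apply: sub; rewrite mem_star eE set21.
  have /hF : [set x; y] \in edges_in S C.
    rewrite !inE cards2 yx xyS /=.
    by apply/subsetP => z; rewrite in_set2 => /orP[]/eqP->.
  case/negP; apply/subsetP => _ /imsetP[z + ->].
  by rewrite in_set2 => /orP[]/eqP-> //; rewrite setUC.
- rewrite !in_setU1 => /predU1P[->|xX] /predU1P[->|yX].
  + by rewrite eqxx.
  + rewrite extv extX // => _ /esym fy; apply: contraTN; apply: hD.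
    by rewrite inE yX fy eqxx.
  + rewrite extv extX // => _ fx; rewrite setUC symD; apply: contraTN; apply: hD.
    by rewrite inE xX fx eqxx.
  + by rewrite !extX //; exact: H3.
Qed.

End GoodColoring.

(** * The greedy coloring with exposure of edges vertex by vertex *)

Section Greedy.
Variables (R : realType) (V : finType) (K : nat) (D : rel V) (p s x d : R).
Hypotheses (symD : symmetric D) (p0 : 0 < p) (p2 : p <= 1 / 2).
Hypotheses (s0 : 0 < s) (x0 : 0 < x).
Implicit Types (S : {set {set V}}) (X C : {set V}) (f : {ffun V -> 'I_K}).

Let p01 : 0 <= p <= 1. Proof. by rewrite ltW //= (le_trans p2) //; lra. Qed.

Local Notation q := (@edge_prob R V p).
Let delta := 2 * s * p.

(** At most [x] singleton obstacles cost exp(-2p) each, and at most [delta * s] = 2 s^2 p pairs cost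
    exp(-2p^2) each; the final 1/2 pays for the degree condition. *)
Definition join_prob : R := expR (- (2 * p * x) - 4 * s ^+ 2 * p ^+ 3) / 2.

Let delta0 : 0 < delta. Proof. by rewrite /delta !mulr_gt0. Qed.

Lemma Pr_joins_obstacles S v C :
    v \notin C -> #|C|%:R <= s -> #|C :&: [set y | D v y]|%:R <= x ->
    #|edges_in S C|%:R <= delta * #|C|%:R ->
  join_prob <= Pr q (joins v C (obstacles D S v C) delta).
Proof.
move=> vC Cs Cx CE.
apply: le_trans (Pr_joins p01 vC delta0 (obstacles_sub D S v C) _); last first.
  rewrite /delta (_ : 2 * s * p / 2 = s * p); last by field.
  by apply: ler_wpM2r => //; exact: ltW.
rewrite /join_prob ler_wpM2r ?invr_ge0 // /obstacles big_cat /=.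
have pow_le (y c : R) k : 0 <= y <= 1 / 2 -> k%:R <= c ->
    expR (- (2 * y) * c) <= (1 - y) ^+ k.
  move=> y12 kc; apply: le_trans (_ : expR (- (2 * y)) ^+ k <= _); last first.
    by apply: lerXn2r; rewrite ?nnegrE ?expR_ge0 ?expR_le_1subr //; lra.
  by rewrite -expRM_natr ler_expR ler_wnM2l //; lra.
have -> : \prod_(e <- [seq [set y] | y in C :&: [set y | D v y]]) (1 - p ^+ #|e|)
    = (1 - p) ^+ #|C :&: [set y | D v y]|.
  rewrite big_map big_enum /= -prodr_const; apply: eq_bigr => y _.
  by rewrite cards1.
have -> : \prod_(e <- enum (edges_in S C)) (1 - p ^+ #|e|)
    = (1 - p ^+ 2) ^+ #|edges_in S C|.
  rewrite big_enum /= -prodr_const; apply: eq_bigr => e.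
  by rewrite !inE => /andP[/eqP->].
apply: le_trans (ler_pM _ _ (pow_le p x _ _ Cx) (pow_le (p ^+ 2) (delta * s) _ _ _));
  rewrite ?expR_ge0 //; last 3 first.
- by rewrite ltW //= p2.
- have /andP[p_ge0 p1] := p01; apply/andP; split; first exact: exprn_ge0.
  by apply: le_trans p2; rewrite expr2 ler_piMl.
- by apply: le_trans CE _; apply: ler_wpM2l => //; exact: ltW.
rewrite -expRD ler_expR /delta le_eqVlt; apply/orP; left; apply/eqP; ring.
Qed.

Lemma join_prob_le1 : join_prob <= 1.
Proof.
have h1 : 0 <= 2 * p * x by rewrite !mulr_ge0 ?ltW.
have h2 : 0 <= 4 * s ^+ 2 * p ^+ 3 by rewrite !mulr_ge0 ?exprn_ge0 ?ltW.
have : expR (- (2 * p * x) - 4 * s ^+ 2 * p ^+ 3) <= expR 0.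
  by rewrite ler_expR; lra.
by rewrite expR0 /join_prob; lra.
Qed.

Lemma join_prob_ge0 : 0 <= join_prob.
Proof. by rewrite mulr_ge0 ?expR_ge0. Qed.

Lemma colorable_in0 S : (0 < K)%N -> colorable_in K D delta set0 S.
Proof.
case: K => // k _; apply/asboolP; exists [ffun => ord0]; split.
- move=> i; rewrite (_ : edges_in _ _ = set0); first by rewrite cards0 mulr_ge0 // ltW.
  apply/setP => e; rewrite !inE; apply/negP => /and3P[/eqP e2 _].
  rewrite (_ : cls _ _ i = set0); last by apply/setP => y; rewrite !inE.
  by rewrite subset0 => /eqP e0; rewrite e0 cards0 in e2.
- by move=> y e; rewrite inE.
- by move=> y z; rewrite inE.
Qed.

(* The classes are disjoint, so the events that [v] can join them are independent
   given the edges inside [X]; at least half of the classes are small and contain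
   few [D]-neighbors of [v]. *)
Lemma greedy_step v X : v \notin X -> #|X :&: [set y | D v y]|%:R <= d ->
    4 * #|X|%:R <= K%:R * s -> 4 * d <= K%:R * x ->
  Pr q (fun S => colorable_in K D delta X S && ~~ colorable_in K D delta (v |: X) S)
    <= expR (- (join_prob * K%:R / 2)).
Proof.
move=> vX dX Ks Kx; rewrite /Pr (Ex_resample _ (star v X)).
apply: (Ex_le_cst (edge_prob01 p01)) => S2.
pose mix (S1 : {set {set V}}) := S1 :&: star v X :|: S2 :\: star v X.
have dsE : [disjoint star v X & edges_in setT X] by exact: star_disjoint_edges_in.
have mixX S1 : mix S1 :&: edges_in setT X = S2 :&: edges_in setT X.
  exact: mix_out.
have colE S1 : colorable_in K D delta X (mix S1) = colorable_in K D delta X S2.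
  by rewrite colorable_in_depends mixX -colorable_in_depends.
case: (asboolP (exists f, good D delta S2 X f)) => [[f gf]|nf]; last first.
  rewrite -[leLHS]/(Pr q (fun S1 => colorable_in K D delta X (mix S1) && _)).
  apply: le_trans (expR_ge0 _); rewrite -[leRHS](Ex_cst q).
  apply: (le_Ex (edge_prob01 p01)) => S1; rewrite colE.
  by have /negPf-> : ~~ colorable_in K D delta X S2 by apply/asboolPn.
pose ok := [set i | (#|cls X f i|%:R <= s)
                    && (#|cls X f i :&: [set y | D v y]|%:R <= x)].
pose jn i := joins v (cls X f i) (obstacles D S2 v (cls X f i)) delta.
have vC i : v \notin cls X f i by rewrite inE (negPf vX).
have clsE i S1 : edges_in (mix S1) (cls X f i) = edges_in S2 (cls X f i).
  have sE : edges_in setT (cls X f i) \subset edges_in setT X.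
    exact/edges_in_subset/cls_sub.
  by rewrite -(edges_in_depends (mix S1) sE) mixX edges_in_depends.
have jnP i S1 : jn i S1 ->
    joins v (cls X f i) (obstacles D (mix S1) v (cls X f i)) delta (mix S1).
  rewrite /jn /obstacles -(clsE i S1) -/(obstacles D (mix S1) v (cls X f i)).
  have jd := joins_depends v delta (obstacles_sub D (mix S1) v (cls X f i)).
  by rewrite (jd S1) (jd (mix S1)) mix_in // star_sub cls_sub.
have gmix S1 : good D delta (mix S1) X f.
  by rewrite good_depends mixX -good_depends.
apply: le_trans (_ : Ex q (fun S1 => \prod_(i <- enum ok) (~~ jn i S1)%:R) <= _).
  apply: (le_Ex (edge_prob01 p01)) => S1; rewrite prod_bool ler_nat -/(mix S1).
  case: (boolP (all _ _)); first by case: (_ && _).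
  case/allPn => i _ /negPn /jnP ji.
  suff -> : colorable_in K D delta (v |: X) (mix S1) by rewrite andbF.
  by apply/asboolP; exists (extend f v i); apply: good_extend.
rewrite (@Ex_indep_prod _ _ _ _ _ (fun i => star v (cls X f i))); first last.
- move=> i j _ _ ij; apply: star_disjoint; apply/pred0P => y /=; rewrite !inE.
  by apply/negP => /andP[/andP[_ /eqP->] /andP[_]]; rewrite (negPf ij).
- move=> i S; congr (~~ _)%:R; apply: joins_depends; exact: obstacles_sub.
- exact: enum_uniq.
have okP i : i \in ok -> Pr q (fun S => ~~ jn i S) <= 1 - join_prob.
  rewrite inE => /andP[is_ ix]; rewrite Pr_not lerD2l lerN2.
  by apply: Pr_joins_obstacles => //; exact: good_few_edges gf i.
rewrite big_enum /=; apply: le_trans (_ : (1 - join_prob) ^+ #|ok| <= _).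
  rewrite -prodr_const; apply: ler_prod => i iok.
  by rewrite (Pr_ge0 (edge_prob01 p01)) okP.
apply: le_trans (_ : expR (- join_prob) ^+ #|ok| <= _).
  apply: lerXn2r; rewrite ?nnegrE ?subr_ge0 ?join_prob_le1 ?expR_ge0 //.
  exact: expR_ge1Dx.
rewrite -expRM_natr ler_expR mulNr lerN2 -mulrA ler_wpM2l ?join_prob_ge0 //.
(* By 4 |X| <= K s and 4 d <= K x, each of the two defects affects at most K/4 classes, which leaves
   K/2 classes in [ok]. *)
pose A1 := [set i | ~~ (#|cls X f i|%:R <= s)].
pose A2 := [set i | ~~ (#|cls (X :&: [set y | D v y]) f i|%:R <= x)].
have cA1 : s * #|A1|%:R <= #|X|%:R by exact: card_big_cls.
have cA2 : x * #|A2|%:R <= d by apply: le_trans dX; exact: card_big_cls.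
have cK : K%:R <= #|ok|%:R + #|A1|%:R + #|A2|%:R :> R.
  rewrite -!natrD ler_nat -[leqLHS](card_ord K) -cardsT.
  rewrite (_ : setT = ok :|: A1 :|: A2); last first.
    apply/setP => i; rewrite !inE.
    have -> : cls X f i :&: [set y | D v y] = cls (X :&: [set y | D v y]) f i.
      by apply/setP => y; rewrite !inE andbAC.
    by case: (_ <= s); case: (_ <= x).
  apply: leq_trans (leq_card_setU _ _) _.
  by rewrite leq_add2r leq_card_setU.
have h1 : #|A1|%:R <= K%:R / 4 :> R.
  by rewrite -(ler_pM2l s0) (le_trans cA1) //; lra.
have h2 : #|A2|%:R <= K%:R / 4 :> R.
  by rewrite -(ler_pM2l x0) (le_trans cA2) //; lra.
lra.
Qed.

(** If [U] is not colorable, some insertion destroys colorability; this is a union bound over the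
    inserted vertex. As the event is the mere existence of a good coloring, each step may use any
    such coloring and no history is tracked. *)
Theorem greedy (U : {set V}) : (0 < K)%N ->
    (forall v, v \in U -> #|U :&: [set y | D v y]|%:R <= d) ->
    4 * #|U|%:R <= K%:R * s -> 4 * d <= K%:R * x ->
  Pr q (fun S => ~~ colorable_in K D delta U S)
    <= #|U|%:R * expR (- (join_prob * K%:R / 2)).
Proof.
move=> K0 dU Ks Kx.
suff H (r : seq V) : uniq r -> {subset r <= U} ->
    Pr q (fun S => ~~ colorable_in K D delta [set y in r] S)
      <= (size r)%:R * expR (- (join_prob * K%:R / 2)).
  have := H (enum U) (enum_uniq _); rewrite set_enum -cardE; apply.
  by move=> y; rewrite mem_enum.
elim: r => [|v r IHr] /=.
  move=> _ _; rewrite mul0r -[leRHS](Ex_cst q).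
  apply: (le_Ex (edge_prob01 p01)) => S.
  rewrite (_ : [set y in [::]] = set0); last by apply/setP => y; rewrite !inE.
  by rewrite colorable_in0.
case/andP => vr ur sU.
have sU' : {subset r <= U} by move=> y yr; apply: sU; rewrite inE yr orbT.
rewrite set_cons; set X := [set y in r].
have XU : X \subset U by apply/subsetP => y; rewrite inE; exact: sU'.
have vX : v \notin X by rewrite inE.
rewrite -add1n natrD mulrDl mul1r addrC.
apply: le_trans (lerD (IHr ur sU') (greedy_step vX _ _ Kx)); first last.
- by apply: le_trans Ks; rewrite ler_wpM2l // ler_nat subset_leq_card.
- apply: le_trans (dU v _); last by apply: sU; rewrite inE eqxx.
  by rewrite ler_nat subset_leq_card // setSI.
apply: le_trans (Pr_or_le (edge_prob01 p01) _ _).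
apply: (le_Pr (edge_prob01 p01)) => S.
by case: (colorable_in _ _ _ X S).
Qed.

End Greedy.

(** * Transfer from random edge sets to the binomial random graph *)

Section GnpLink.
Variables (R : realType) (n : nat) (p : R).
Hypothesis p01 : 0 <= p <= 1.
Local Notation q := (@edge_prob R 'I_n p).

Lemma Gnp_mass_wt (G : sgraph 'I_n) : Gnp_mass p G = wt q (edges G).
Proof.
rewrite /Gnp_mass /wt big_mkcond /=; apply: eq_bigr => e _; rewrite /edge_prob.
case: ifPn => // eP; rewrite ifN ?subr0 //.
by apply: contra eP; apply: (subsetP (edges_pairs G)).
Qed.

(** An edge set containing a non-pair has weight 0, so the graphs carry the whole measure. *)
Lemma Gnp_sum (h : {set {set 'I_n}} -> R) :
  \sum_(G : sgraph 'I_n) Gnp_mass p G * h (edges G) = Ex q h.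
Proof.
rewrite /Ex (bigID (fun S : {set {set 'I_n}} => S \subset pairs 'I_n)) /=.
rewrite [X in _ = _ + X]big1 ?addr0; last first.
  move=> S /subsetPn[e eS eP]; rewrite /wt (bigD1 e) //= eS /edge_prob.
  by rewrite (negPf eP) !mul0r.
rewrite [RHS](reindex_omap (op := +%R) (@edges 'I_n)
  (insub : {set {set 'I_n}} -> option (sgraph 'I_n))) /=; last first.
  by move=> S SP; rewrite insubT.
apply: eq_big => [G|G _]; last by rewrite Gnp_mass_wt.
by rewrite edges_pairs valK eqxx.
Qed.

Lemma Gnp_prob_le1 (A : pred (sgraph 'I_n)) : Gnp_prob p A <= 1.
Proof.
rewrite /Gnp_prob -[leRHS](Ex_cst q 1) -Gnp_sum [leLHS]big_mkcond /=.
apply: ler_sum => G _; rewrite mulr1; case: (A G) => //.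
by rewrite Gnp_mass_wt; apply: (wt_ge0 (edge_prob01 p01)).
Qed.

Lemma Gnp_prob_ge (A : pred (sgraph 'I_n)) (B : {set {set 'I_n}} -> bool) :
  (forall G, ~~ B (edges G) -> A G) -> 1 - Pr q B <= Gnp_prob p A.
Proof.
move=> BA; rewrite -Pr_not /Pr -Gnp_sum /Gnp_prob [leRHS]big_mkcond /=.
apply: ler_sum => G _; have := BA G; rewrite Gnp_mass_wt.
have := wt_ge0 (edge_prob01 p01) (edges G).
by case: (B _) => [w0 _|w0 /(_ isT) ->]; rewrite /= ?mulr0 ?mulr1 //; case: ifP.
Qed.

End GnpLink.

(** * Deterministic bounds on the clique chromatic number *)

Section CliqueColoring.
Variable V : finType.
Implicit Types (G : sgraph V).

Lemma edge_neq G x y : [set x; y] \in edges G -> x != y.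
Proof.
move=> /(subsetP (edges_pairs G)); rewrite inE cards2.
by case: (x != y).
Qed.

(** A monochromatic clique with an edge xy has no third vertex, which would close a triangle; a
    common neighbor of x and y then enlarges it, so it was not maximal. An arbitrary finite type of
    colors allows product palettes. *)
Lemma clique_chromatic_le (C : finType) (f : V -> C) G :
    (forall x y z, f x = f y -> f x = f z -> [set x; y] \in edges G ->
       [set x; z] \in edges G -> [set y; z] \in edges G -> False) ->
    (forall x y, f x = f y -> [set x; y] \in edges G ->
       exists w, [set x; w] \in edges G /\ [set y; w] \in edges G) ->
  (clique_chromatic G <= #|C|)%N.
Proof.
move=> notri common; rewrite /clique_chromatic; case: ex_minnP => k _; apply.
apply/existsP; exists [ffun x => enum_rank (f x)].
apply/forallP => Q; apply/implyP => /andP[/maxsetP[Qcl Qmax] Q1].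
apply/negP => /forall_inP mono.
have fQ x y : x \in Q -> y \in Q -> f x = f y.
  move=> xQ yQ; have /forall_inP/(_ y yQ)/eqP := mono x xQ.
  by rewrite !ffunE => /enum_rank_inj.
have eQ x y : x \in Q -> y \in Q -> x != y -> [set x; y] \in edges G.
  by move=> xQ yQ xy; move/forall_inP: Qcl => /(_ x xQ)/forall_inP/(_ y yQ)/implyP; apply.
have [x [y [xQ yQ xy]]] := card_gt1P Q1.
have [w [xw yw]] := common x y (fQ x y xQ yQ) (eQ x y xQ yQ xy).
case: (boolP [exists z in Q, (z != x) && (z != y)]) => [|/exists_inPn only].
  case/exists_inP => z zQ /andP[zx zy].
  by apply: (notri x y z); rewrite ?(fQ x y) ?(fQ y z) ?eQ // eq_sym.
have Qxy : Q = [set x; y].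
  apply/setP => z; rewrite in_set2; apply/idP/orP => [zQ|[]/eqP-> //].
  by have := only z zQ; rewrite negb_and !negbK => /orP.
have wQ : w \notin Q.
  rewrite Qxy in_set2 negb_or eq_sym (edge_neq xw) eq_sym.
  exact: edge_neq yw.
have /Qmax : clique G (w |: Q).
  apply/forall_inP => a aQ; apply/forall_inP => b bQ; apply/implyP => ab.
  move: aQ bQ ab; rewrite Qxy !in_setU !in_set1.
  case/or3P => /eqP-> /or3P[]/eqP->; rewrite ?eqxx // => _;
    try (by rewrite ?xw ?yw ?(eQ x y)); rewrite setUC ?xw ?yw ?(eQ x y) //.
by move=> /(_ (subsetUr _ _)) QE; rewrite -QE setU11 in wQ.
Qed.

Lemma bounded_degree_coloring (H : rel V) k : (0 < k)%N -> symmetric H ->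
    (forall x, #|[set y | H x y]| < k)%N ->
  exists f : V -> 'I_k, forall x y, x != y -> H x y -> f x != f y.
Proof.
case: k => // k _ symH degH.
suff [f fP] : exists f : V -> 'I_k.+1, forall x y,
    x \in enum V -> y \in enum V -> x != y -> H x y -> f x != f y.
  by exists f => x y; apply: fP; rewrite mem_enum.
elim: (enum V) => [|v r [f fP]]; first by exists (fun=> ord0) => x y; rewrite in_nil.
have /existsP[c cP] : [exists c : 'I_k.+1, c \notin [set f y | y in [set y | H v y]]].
  rewrite -negb_forall; apply/negP => /forallP all_c.
  have : (k.+1 <= #|[set f y | y in [set y | H v y]]|)%N.
    rewrite -[leqLHS]card_ord -cardsT subset_leq_card //.
    by apply/subsetP => c _; exact: all_c.
  by rewrite leqNgt (leq_ltn_trans (leq_imset_card _ _)).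
have cH y : H v y -> f y != c.
  by move=> Hvy; apply: contraNneq cP => <-; apply: imset_f; rewrite inE.
exists (fun x => if x == v then c else f x) => x y.
rewrite !inE; case: (eqVneq x v) => [->|xv] /=; case: (eqVneq y v) => [->|yv] //=.
- by move=> _ _ _ /cH; rewrite eq_sym.
- by move=> _ _ _; rewrite symH => /cH.
- exact: fP.
Qed.

End CliqueColoring.

(** A slightly weakened second Bonferroni inequality, factored so that the correction 1 - pd/2 can
    be carried through the exponents below. *)
Lemma pow_1sub_le (R : realFieldType) (p : R) d : 0 <= p <= 1 ->
  (1 - p) ^+ d <= 1 - p * d%:R * (1 - p * d%:R / 2).
Proof.
move=> /andP[p0 p1]; elim: d => [|d IHd]; first by rewrite expr0; lra.
rewrite exprS; apply: le_trans (_ : (1 - p) * (1 - p * d%:R * (1 - p * d%:R / 2)) <= _).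
  by rewrite ler_wpM2l // subr_ge0.
rewrite -[d.+1%:R]natr1; have d0 : 0 <= d%:R :> R by rewrite ler0n.
have : 0 <= p ^+ 3 * d%:R ^+ 2 by rewrite mulr_ge0 ?exprn_ge0.
have : 0 <= p ^+ 2 by rewrite exprn_ge0.
nra.
Qed.

(** * Probability that a vertex has no common neighbor with any vertex of a set *)

Section CommonNeighbor.
Variables (R : realType) (V : finType) (p : R).
Hypothesis p01 : 0 <= p <= 1.
Local Notation q := (@edge_prob R V p).
Implicit Types (S : {set {set V}}) (T W U : {set V}).

Definition no_common S W (v u : V) : bool :=
  [forall w in W, ~~ (([set w; v] \in S) && ([set w; u] \in S))].

Definition no_common_all W v T S : bool := [forall u in T, no_common S W v u].

(** It fails when [w] is a common neighbor of [v] and some vertex of [T]. Grouping by [w] gives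
    independent events on disjoint stars; grouping by the vertices of [T] would not, because the
    edges from [w] to [v] would be shared. *)
Definition spoke v T w S : bool :=
  ~~ (([set w; v] \in S) && ~~ [disjoint star w T & S]).

Lemma no_common_allE W v T S :
  no_common_all W v T S = all (fun w => spoke v T w S) (enum W).
Proof.
apply/forall_inP/allP => [H w|H u uT].
  rewrite mem_enum => wW; apply/negP => /andP[wv /pred0Pn[e /andP[]]].
  case/imsetP => u uT -> wu; have /forall_inP/(_ w wW) := H u uT.
  by rewrite wv /=; move/negP; apply; exact: wu.
apply/forall_inP => w wW; apply/negP => /andP[wv wu].
have := H w; rewrite mem_enum => /(_ wW); rewrite /spoke wv /= negbK.
by move=> /disjointFr/(_ (_ : [set w; u] \in star w T))/negP; apply; rewrite ?mem_star.
Qed.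

Lemma spoke_depends v T w : depends (star w (v |: T)) (spoke v T w).
Proof.
move=> S; rewrite /spoke in_setI mem_star setU11 andbT; congr (~~ (_ && ~~ _)).
have sT : star w T \subset star w (v |: T) by rewrite star_sub subsetUr.
by rewrite -!setI_eq0 [S :&: _]setIC setIA (setIidPl sT).
Qed.

Lemma Pr_spoke v T w : w \notin T -> v \notin T -> w != v ->
  Pr q (spoke v T w) = 1 - p * (1 - (1 - p) ^+ #|T|).
Proof.
move=> wT vT wv; rewrite /spoke Pr_not; congr (1 - _).
have vtP u : u != w -> q [set w; u] = p.
  move=> uw; rewrite /edge_prob (subsetP (star_pairs (v := w) (X := [set u]) _)) //.
    by rewrite inE eq_sym.
  by rewrite mem_star inE.
rewrite -[X in X * (_ - _)](vtP v) 1?eq_sym // -Pr_mem.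
have -> : (1 - p) ^+ #|T| = Pr q (fun S => [disjoint star w T & S]).
  rewrite Pr_disjoint big_imset /=; last by move=> x y _ _ /set2_inj.
  rewrite -prodr_const; apply: eq_bigr => u uT; rewrite vtP //.
  by apply: contraNneq wT => <-.
rewrite -Pr_not -(@Ex_indep _ _ q [set [set w; v]] (star w T)).
- by apply: eq_Ex => S; case: (_ \in S); rewrite ?mul1r ?mul0r.
- by move=> S; rewrite in_setI set11 andbT.
- move=> S; congr (~~ _)%:R; rewrite -!setI_eq0.
  by rewrite [S :&: _]setIC setIA setIid.
- by rewrite disjoints1 mem_star.
Qed.

Lemma Pr_spoke_le v T w : w \notin T -> v \notin T -> w != v ->
  Pr q (spoke v T w) <= expR (- (p ^+ 2 * #|T|%:R * (1 - p * #|T|%:R / 2))).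
Proof.
move=> wT vT wv; rewrite Pr_spoke //.
apply: le_trans (expR_ge1Dx _); rewrite lerD2l lerN2 expr2 -!mulrA.
have /andP[pge0 _] := p01; apply: ler_wpM2l => //.
by rewrite mulrA lerBrDr -lerBrDl; apply: le_trans (pow_1sub_le _ p01) _; lra.
Qed.

Lemma no_common_depends W v T :
  depends (\bigcup_(w in W) star w (v |: T)) (no_common_all W v T).
Proof.
move=> S; rewrite !no_common_allE; apply: eq_in_all => w; rewrite mem_enum => wW.
have sA : star w (v |: T) \subset \bigcup_(w in W) star w (v |: T).
  exact: (finset.bigcup_sup w wW).
exact: (depends_sub sA (@spoke_depends v T w)).
Qed.

Lemma Pr_no_common_all W v T :
    v \notin W -> v \notin T -> [disjoint T & W] ->
  Pr q (no_common_all W v T) <=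
  expR (- (p ^+ 2 * #|T|%:R * (1 - p * #|T|%:R / 2))) ^+ #|W|.
Proof.
move=> vW vT dTW.
have dis w w' u : w \in W -> w' \in W -> u \in v |: T -> w != w' ->
    [set w; u] \notin star w' (v |: T).
  move=> wW w'W uT ww'; apply/negP => /imsetP[u' u'T e].
  have : w \in [set w'; u'] by rewrite -e set21.
  rewrite in_set2 (negPf ww') /= => /eqP wu'; move: u'T.
  rewrite -wu' in_setU1 => /predU1P[wv|wT]; first by rewrite -wv wW in vW.
  by rewrite (disjointFr dTW wT) in wW.
have -> : Pr q (no_common_all W v T) =
    Ex q (fun S => \prod_(w <- enum W) (spoke v T w S)%:R).
  by apply: eq_Ex => S; rewrite no_common_allE prod_bool.
rewrite (@Ex_indep_prod _ _ q _ _ (fun w => star w (v |: T))) ?enum_uniq //.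
- rewrite big_enum /= -prodr_const; apply: ler_prod => w wW.
  rewrite (Pr_ge0 (edge_prob01 p01)) /= Pr_spoke_le //.
    by rewrite (disjointFl dTW wW).
  by apply: contraNneq vW => <-.
- by move=> w S; rewrite spoke_depends.
- move=> w w'; rewrite !mem_enum => wW w'W ww'.
  apply/pred0P => e /=; apply/negP => /andP[/imsetP[u uT ->]].
  exact/negP/dis.
Qed.

(** As [W] avoids [v] and [T], no edge from [v] to [T] belongs to a star centered in [W]; the two
    events are independent. *)
Lemma Pr_star_no_common W v T :
    v \notin W -> v \notin T -> [disjoint T & W] ->
  Pr q (fun S => (star v T \subset S) && no_common_all W v T S) <=
  p ^+ #|T| * expR (- (p ^+ 2 * #|T|%:R * (1 - p * #|T|%:R / 2))) ^+ #|W|.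
Proof.
move=> vW vT dTW.
have -> : Pr q (fun S => (star v T \subset S) && no_common_all W v T S) =
    Ex q (fun S => (star v T \subset S)%:R * (no_common_all W v T S)%:R).
  by apply: eq_Ex => S; case: (star v T \subset S); rewrite ?mul1r ?mul0r.
rewrite (@Ex_indep _ _ q (star v T) (\bigcup_(w in W) star w (v |: T))).
- rewrite -[X in X * _]/(Pr q (fun S => star v T \subset S)) Pr_subset prod_star //.
  apply: ler_wpM2l (Pr_no_common_all vW vT dTW).
  by have /andP[pge0 _] := p01; rewrite exprn_ge0.
- by move=> S; rewrite subsetI subxx andbT.
- by move=> S; rewrite no_common_depends.
apply/pred0P => e /=; apply/negP => /andP[/imsetP[u uT ->]].
move=> /bigcupP[w wW /imsetP[u' _ e']].
have : w \in [set v; u] by rewrite e' set21.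
rewrite in_set2 => /orP[]/eqP wv; first by rewrite -wv wW in vW.
by rewrite wv (disjointFr dTW uT) in wW.
Qed.

End CommonNeighbor.

Lemma bin_le_expn (R : realFieldType) n k : 'C(n, k)%:R <= n%:R ^+ k :> R.
Proof.
rewrite -natrX ler_nat; apply: (@leq_trans (n ^_ k)).
  by rewrite -bin_ffact leq_pmulr // fact_gt0.
elim: k => [|k IHk]; first by rewrite expn0.
by rewrite ffactnSr expnSr leq_mul // leq_subr.
Qed.

(** Multiplied by k!, this compares falling factorials with powers on each side. It turns the
    quotient of binomials produced by Markov's inequality into (m/t)^k. *)
Lemma bin_ratio (R : realFieldType) m t k :
  'C(m, k)%:R * t%:R ^+ k <= m%:R ^+ k * 'C(t + k, k)%:R :> R.
Proof.
rewrite -!natrX -!natrM ler_nat -(@leq_pmul2r k`!) ?fact_gt0 //.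
rewrite -mulnA (mulnC _ k`!) mulnA bin_ffact -mulnA bin_ffact leq_mul //.
  elim: k => [|k IHk]; first by rewrite expn0.
  by rewrite ffactnSr expnSr leq_mul // leq_subr.
elim: k => [|k IHk]; first by rewrite expn0.
by rewrite addnS ffactnS expnS leq_mul //; apply: leq_trans (leq_addr _ _) _.
Qed.

(** * Degrees in the graph of pairs without a common neighbor *)

Section DegreeBounds.
Variables (R : realType) (V : finType) (p : R).
Hypothesis p01 : 0 <= p <= 1.
Local Notation q := (@edge_prob R V p).
Implicit Types (S : {set {set V}}) (T U W : {set V}).

(** Excluding it bounds by k - 1 the number of edges at a vertex that lie in no triangle. Looking
    for common neighbors outside [v |: T] only enlarges the event and keeps its two conditions
    independent. *)
Definition lonely_star k S : bool :=
  [exists v, [exists T : {set V}, [&& #|T| == k, v \notin T &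
    (star v T \subset S) && no_common_all (~: (v |: T)) v T S]]].

Lemma Pr_lonely_star k : (k < #|V|)%N ->
  Pr q (lonely_star k) <= #|V|%:R * ((#|V|%:R * p) ^+ k *
    expR (- (p ^+ 2 * k%:R * (1 - p * k%:R / 2))) ^+ (#|V| - k.+1)).
Proof.
move=> kV; set b := (_ * p) ^+ k * _.
have /andP[p0 p1] := p01.
pose B v T S := (star v T \subset S) && no_common_all (~: (v |: T)) v T S.
have bT v T : #|T| = k -> v \notin T -> Pr q (B v T) <=
    p ^+ k * expR (- (p ^+ 2 * k%:R * (1 - p * k%:R / 2))) ^+ (#|V| - k.+1).
  move=> Tk vT; have := @Pr_star_no_common R V p p01 (~: (v |: T)) v T.
  rewrite in_setC setU11 => /(_ isT vT).
  rewrite Tk cardsCs setCK cardsU1 vT Tk add1n; apply.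
  by rewrite disjoint_sym disjoints_subset setCS subsetUr.
apply: le_trans (_ : \sum_(v : V) b <= _); last first.
  by rewrite sumr_const mulr_natl.
apply: le_trans (ler_sum _ _); last first.
  move=> v _; apply: le_trans (_ : \sum_(T : {set V} | (#|T| == k) && (v \notin T))
      Pr q (B v T) <= _).
    exact: lexx.
  apply: le_trans (_ : \sum_(T : {set V} | #|T| == k)
     p ^+ k * expR (- (p ^+ 2 * k%:R * (1 - p * k%:R / 2))) ^+ (#|V| - k.+1) <= _).
    rewrite big_mkcondr; apply: ler_sum => T /eqP Tk.
    case: ifP => [vT|_]; first exact: bT.
    by rewrite mulr_ge0 ?exprn_ge0 ?expR_ge0.
  rewrite sumr_const -[leLHS]mulr_natl /b exprMn -[leRHS]mulrA.
  apply: ler_wpM2r; first by rewrite mulr_ge0 ?exprn_ge0 ?expR_ge0.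
  rewrite (_ : #|_| = 'C(#|V|, k)) ?bin_le_expn //.
  by rewrite -card_draws; apply: eq_card => T; rewrite inE.
apply: le_trans (_ : Pr q (fun S => [exists v, true && [exists T : {set V},
    ((#|T| == k) && (v \notin T)) && B v T S]]) <= _).
  apply: (le_Pr (edge_prob01 p01)) => S /existsP[v /existsP[T /and3P[Tk vT BS]]].
  by apply/existsP; exists v; apply/existsP; exists T; rewrite Tk vT.
apply: le_trans (Pr_exists_le (edge_prob01 p01) _ _) _.
by apply: ler_sum => v _; apply: Pr_exists_le; exact: edge_prob01.
Qed.

(* Common neighbors are only sought outside [U], so that [far S U] does not depend on
   the edges inside [U], along which the greedy coloring is exposed. *)
Definition far S U (x y : V) : bool := (x != y) && no_common S (~: U) x y.

Lemma far_sym S U : symmetric (far S U).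
Proof.
move=> x y; rewrite /far eq_sym; congr andb.
by apply: eq_forallb_in => w _; rewrite andbC.
Qed.

(* Markov's inequality for the number of [k]-subsets of the [far]-neighborhood. *)
Lemma Pr_far_degree U v (t k : nat) (Q : R) : v \in U -> (0 < t)%N ->
    expR (- (p ^+ 2 * (1 - p * k%:R / 2))) ^+ (#|V| - #|U|) <= Q ->
  Pr q (fun S => t + k <= #|U :&: [set y | far S U v y]|)%N
    <= (#|U|%:R * Q / t%:R) ^+ k.
Proof.
move=> vU t0 hQ.
pose N S := U :&: [set y | far S U v y].
have Q0 : 0 <= Q by apply: le_trans hQ; rewrite exprn_ge0 ?expR_ge0.
have C0 : 0 < 'C(t + k, k)%:R :> R by rewrite ltr0n bin_gt0 leq_addl.
apply: le_trans (_ : Pr q (fun S => 'C(t + k, k)%:R <= ('C(#|N S|, k)%:R : R)) <= _).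
  apply: (le_Pr (edge_prob01 p01)) => S le_tk; rewrite ler_nat.
  exact: leq_bin2l.
apply: le_trans (markov_Ex (edge_prob01 p01) C0 _) _ => [S|]; first by rewrite ler0n.
have -> : Ex q (fun S => 'C(#|N S|, k)%:R) = \sum_(T : {set V} | (T \subset U) && (#|T| == k))
    Pr q (fun S => T \subset N S).
  rewrite -Ex_sum; apply: eq_Ex => S; rewrite -cards_draws -sum1_card natr_sum.
  rewrite big_mkcond [RHS]big_mkcond /=; apply: eq_bigr => T _; rewrite inE.
  rewrite [T \subset N S]subsetI; case: (T \subset U) => //=.
  by case: (_ == k); rewrite ?andbT ?andbF //; case: ifP.
rewrite ler_pdivrMr // exprMn exprVn.
apply: le_trans (_ : 'C(#|U|, k)%:R * Q ^+ k <= _); last first.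
  have t0' : 0 < t%:R ^+ k :> R by rewrite exprn_gt0 // ltr0n.
  rewrite mulrAC ler_pdivlMr // exprMn.
  have := bin_ratio R #|U| t k => h.
  rewrite mulrAC [leRHS]mulrAC; apply: ler_wpM2r => //; exact: exprn_ge0.
rewrite -cards_draws mulr_natl -sumr_const [leRHS]big_mkcond [leLHS]big_mkcond.
apply: ler_sum => T _; rewrite inE; case: ifPn => // /andP[TU /eqP Tk].
(* Sets containing [v] contribute nothing, since [far] is irreflexive. *)
case: (boolP (v \in T)) => vT.
  rewrite (_ : Pr _ _ = 0) ?exprn_ge0 // -[RHS](Ex_cst q); apply: eq_Ex => S.
  suff /negPf -> : ~~ (T \subset N S) by [].
  by apply/subsetPn; exists v => //; rewrite !inE /far eqxx andbF.
(* The exponent is linear in |T| up to the correction factor, so the k vertices of [T] behave as if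
   independent and the bound is [Q ^+ k]. *)
apply: le_trans (_ : Pr q (no_common_all (~: U) v T) <= _).
  apply: (le_Pr (edge_prob01 p01)) => S /subsetP TN; apply/forall_inP => u uT.
  by have := TN u uT; rewrite !inE => /and3P[].
apply: le_trans (Pr_no_common_all p01 _ vT _) _; rewrite ?in_setC ?vU //.
  by rewrite disjoints_subset setCK.
rewrite Tk (cardsCs (~: U)) setCK.
apply: le_trans (_ : (expR (- (p ^+ 2 * (1 - p * k%:R / 2))) ^+ (#|V| - #|U|)) ^+ k <= _).
  rewrite exprAC lerXn2r ?nnegrE ?exprn_ge0 ?expR_ge0 //.
  rewrite -expRM_natr ler_expR le_eqVlt; apply/orP; left; apply/eqP; ring.
by rewrite lerXn2r ?nnegrE ?exprn_ge0 ?expR_ge0.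
Qed.

End DegreeBounds.

(** * Coloring one part in two rounds of exposure *)

Section ProbabilityBounds.
Variables (R : realType) (V : finType) (p : R).
Hypotheses (p0 : 0 < p) (p2 : p <= 1 / 2).
Implicit Types (S : {set {set V}}) (T U W : {set V}).
Let p01 : 0 <= p <= 1. Proof. by rewrite ltW //= (le_trans p2) //; lra. Qed.
Local Notation q := (@edge_prob R V p).

Lemma far_depends U : depends (~: edges_in setT U) (fun S => far S U).
Proof.
move=> S; apply/funext => x; apply/funext => y; rewrite /far; congr andb.
apply: eq_forallb_in => w; rewrite in_setC => wU.
have memE z : [set w; z] \in ~: edges_in setT U.
  rewrite !inE andTb negb_and; apply/orP; right; apply/subsetPn; exists w => //.
  by rewrite set21.
by rewrite !in_setI !memE !andbT.
Qed.

(** The edges not inside [U] come first: they determine [far], and a large degree in it is the first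
    failure term. With [far] frozen, [greedy] runs on the edges inside [U]. *)
Lemma Pr_part U (K t k : nat) (s x Q : R) :
    0 < s -> 0 < x -> (0 < K)%N -> (0 < t)%N ->
    expR (- (p ^+ 2 * (1 - p * k%:R / 2))) ^+ (#|V| - #|U|) <= Q ->
    4 * #|U|%:R <= K%:R * s -> 4 * (t + k)%:R <= K%:R * x ->
  Pr q (fun S => ~~ colorable_in K (far S U) (2 * s * p) U S)
    <= #|U|%:R * ((#|U|%:R * Q / t%:R) ^+ k + expR (- (join_prob p s x * K%:R / 2))).
Proof.
move=> s0 x0 K0 t0 hQ hs hx; set eps := expR (- (_ / 2)).
pose bad S := [exists v, (v \in U) && (t + k <= #|U :&: [set y | far S U v y]|)%N].
have Pbad : Pr q bad <= #|U|%:R * (#|U|%:R * Q / t%:R) ^+ k.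
  apply: le_trans (Pr_exists_le (edge_prob01 p01) _ _) _.
  rewrite mulr_natl -sumr_const; apply: ler_sum => v vU.
  exact: Pr_far_degree.
rewrite mulrDr; apply: le_trans (lerD Pbad (lexx _)).
rewrite /Pr (Ex_resample _ (edges_in setT U)).
rewrite -[X in _ <= _ + X](Ex_cst q) -ExD.
apply: (le_Ex (edge_prob01 p01)) => S2.
pose mix (S1 : {set {set V}}) := S1 :&: edges_in setT U :|: S2 :\: edges_in setT U.
have farE S1 : far (mix S1) U = far S2 U.
  rewrite far_depends [RHS]far_depends mix_out //.
  by rewrite disjoints_subset setCK.
apply: le_trans (_ : Pr q (fun S1 => ~~ colorable_in K (far S2 U) (2 * s * p) U S1) <= _).
  apply: (le_Pr (edge_prob01 p01)) => S1; rewrite -/(mix S1) farE.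
  by rewrite colorable_in_depends mix_in // -colorable_in_depends.
case: (boolP (bad S2)) => [_|nbad].
  apply: le_trans (_ : 1 <= _); first by apply: Ex_le_cst => [e|S1];
    [exact: edge_prob01|by rewrite lern1; case: (~~ _)].
  by rewrite /= lerDl mulr_ge0 ?expR_ge0.
rewrite add0r; apply: (@greedy R V K (far S2 U) p s x (t + k)%:R) => //.
  exact: far_sym.
move=> v vU; rewrite ler_nat leqNgt; apply: contra nbad => h.
by apply/existsP; exists v; rewrite vU ltnW.
Qed.

End ProbabilityBounds.

(** * From good colorings to clique colorings *)

Section GraphColoring.
Variables (R : realType) (V : finType) (K : nat) (delta : R).
Implicit Types (G : sgraph V) (U : {set V}).

Lemma good_no_triangle (D : rel V) G U (f : {ffun V -> 'I_K}) x y z :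
    good D delta (edges G) U f -> x \in U -> y \in U -> z \in U ->
    f x = f y -> f x = f z -> [set x; y] \in edges G ->
  [set x; z] \in edges G -> [set y; z] \in edges G -> False.
Proof.
move=> gf xU yU zU fxy fxz xy xz yz.
suff /negP : ~~ (star x [set y; z] \subset edges G).
  by apply; apply/subsetP => _ /imsetP[u + ->]; rewrite in_set2 => /orP[]/eqP->.
apply: (good_triangle_free gf xU).
- rewrite !inE cards2 (edge_neq yz) yz /=.
  by apply/subsetP => u; rewrite !inE => /orP[]/eqP->; rewrite ?yU ?zU -?fxy -?fxz eqxx.
- by rewrite in_set2 negb_or (edge_neq xy) (edge_neq xz).
Qed.

Lemma clique_chromatic_parts L (part : V -> 'I_L) G :
    (forall j, colorable_in K (far (edges G) [set x | part x == j]) delta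
                 [set x | part x == j] (edges G)) ->
  (clique_chromatic G <= L * K)%N.
Proof.
move=> col; pose U j := [set x | part x == j].
have goodU j : exists f : {ffun V -> 'I_K},
    good (far (edges G) (U j)) delta (edges G) (U j) f.
  exact/asboolP/col.
have [F gF] := fin_all_exists goodU.
have := @clique_chromatic_le V ('I_L * 'I_K)%type (fun x => (part x, F (part x) x)) G.
rewrite card_prod !card_ord; apply.
  move=> x y z [pxy fxy] [pxz fxz].
  by apply: (good_no_triangle (gF (part x)) (x := x)); rewrite ?inE -?pxy -?pxz ?eqxx //;
    [rewrite fxy pxy|rewrite fxz pxz].
move=> x y [pxy fxy] xy.
have := good_edge (gF (part x)) (x := x) (y := y).
rewrite !inE -pxy eqxx (edge_neq xy) => /(_ isT isT isT) H.
have := H (etrans fxy (congr1 (fun j => F j y) (esym pxy))) xy.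
rewrite /far (edge_neq xy) /= => /forall_inPn[w _]; rewrite negbK => /andP[wx wy].
by exists w; rewrite !(setUC _ [set w]).
Qed.

(** In the product coloring the first coordinate excludes triangles and the second separates the
    ends of every edge without a common neighbor, so the greedy coloring can use the empty
    relation. *)
Lemma clique_chromatic_lonely k G : (0 < k)%N ->
    colorable_in K (fun _ _ : V => false) delta setT (edges G) ->
    ~~ lonely_star k (edges G) ->
  (clique_chromatic G <= K * k)%N.
Proof.
move=> k0 /asboolP[f gf] nlon.
pose H x y := ([set x; y] \in edges G) && no_common (edges G) setT x y.
have [||c cP] := @bounded_degree_coloring V H k k0.
- move=> x y; rewrite /H setUC; congr andb.
  by apply: eq_forallb_in => w _; rewrite andbC.
- move=> v; rewrite ltnNge; apply: contra nlon => kH.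
  have := bin_gt0 #|[set y | H v y]| k; rewrite kH -cards_draws.
  move=> /card_gt0P[T]; rewrite inE => /andP[/subsetP TH Tk].
  apply/existsP; exists v; apply/existsP; exists T; rewrite Tk /=.
  have TE u : u \in T -> H v u by move=> /TH; rewrite inE.
  apply/and3P; split.
  + by apply/negP => /TE /andP[/edge_neq]; rewrite eqxx.
  + by apply/subsetP => _ /imsetP[u /TE/andP[vu _] ->].
  + apply/forall_inP => u /TE/andP[_ /forall_inP H'].
    by apply/forall_inP => w _; apply: H'; rewrite inE.
have := @clique_chromatic_le V ('I_K * 'I_k)%type (fun x => (f x, c x)) G.
rewrite card_prod !card_ord; apply.
  by move=> x y z [fxy _] [fxz _]; apply: (good_no_triangle gf); rewrite ?inE.
move=> x y [_ cxy] xy; have := cP x y (edge_neq xy).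
rewrite cxy eqxx /H xy /=; case: (boolP (no_common _ _ _ _)) => [_ /(_ isT)//|].
move=> /forall_inPn[w _]; rewrite negbK => /andP[wx wy] _.
by exists w; rewrite !(setUC _ [set w]).
Qed.

End GraphColoring.

(** * Bounds for the random graph with free parameters *)

Section GnpBounds.
Variables (R : realType) (n : nat) (p : R).
Hypotheses (p0 : 0 < p) (p2 : p <= 1 / 2).
Let p01 : 0 <= p <= 1. Proof. by rewrite ltW //= (le_trans p2) //; lra. Qed.

Lemma Gnp_parts L K t k (part : 'I_n -> 'I_L) (s x m Q : R) :
    0 < s -> 0 < x -> (0 < K)%N -> (0 < t)%N ->
    (forall j, #|[set v | part v == j]|%:R <= m) ->
    (forall j, expR (- (p ^+ 2 * (1 - p * k%:R / 2)))
                 ^+ (n - #|[set v | part v == j]|) <= Q) ->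
    4 * m <= K%:R * s -> 4 * (t + k)%:R <= K%:R * x ->
  1 - n%:R * ((m * Q / t%:R) ^+ k + expR (- (join_prob p s x * K%:R / 2)))
    <= Gnp_prob p (fun G : sgraph 'I_n => (clique_chromatic G <= L * K)%N).
Proof.
move=> s0 x0 K0 t0 hm hQ hs hx; set eps := expR (- (_ / 2)).
pose U j := [set v | part v == j].
pose B S := [exists j, true && ~~ colorable_in K (far S (U j)) (2 * s * p) (U j) S].
have BA G : ~~ B (edges G) -> (clique_chromatic G <= L * K)%N.
  move=> nB; apply: (@clique_chromatic_parts R _ _ (2 * s * p) _ part) => j.
  apply: contraNT nB => nc; apply/existsP; exists j.
  exact: nc.
apply: le_trans (Gnp_prob_ge p01 BA); rewrite lerD2l lerN2.
apply: le_trans (Pr_exists_le (edge_prob01 p01) _ _) _.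
have t0' : 0 < t%:R :> R by rewrite ltr0n.
(* The failure bound of a part is proportional to its size, so the sum over the parts gives a factor
   n. *)
have n_sum : n = \sum_j #|U j|.
  rewrite -[LHS]card_ord -sum1_card (partition_big part xpredT) //=.
  by apply: eq_bigr => j _; rewrite -sum1_card; apply: eq_bigl => v; rewrite inE.
rewrite [X in _ <= X%:R * _]n_sum natr_sum mulr_suml; apply: ler_sum => j _.
have Q0 : 0 <= Q by apply: le_trans (hQ j); rewrite exprn_ge0 ?expR_ge0.
apply: le_trans (@Pr_part R _ p p0 p2 (U j) K t k s x Q s0 x0 K0 t0 _ _ hx) _.
- by rewrite card_ord; exact: hQ.
- by apply: le_trans hs; apply: ler_wpM2l => //; exact: hm.
apply: ler_wpM2l => //; rewrite lerD2r lerXn2r ?nnegrE //.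
- by rewrite divr_ge0 ?mulr_ge0.
- by rewrite divr_ge0 ?mulr_ge0 ?(le_trans _ (hm j)).
rewrite ler_wpM2r ?invr_ge0 ?(ltW t0') //; apply: ler_wpM2r => //; exact: hm.
Qed.

Lemma Gnp_lonely K k (s : R) :
    0 < s -> (0 < K)%N -> (0 < k)%N -> (k < n)%N -> 4 * n%:R <= K%:R * s ->
  1 - n%:R * ((n%:R * p) ^+ k *
      expR (- (p ^+ 2 * k%:R * (1 - p * k%:R / 2))) ^+ (n - k.+1)
      + expR (- (join_prob p s 1 * K%:R / 2)))
    <= Gnp_prob p (fun G : sgraph 'I_n => (clique_chromatic G <= K * k)%N).
Proof.
move=> s0 K0 k0 kn hs.
pose D (_ _ : 'I_n) := false.
pose B S := lonely_star k S || ~~ colorable_in K D (2 * s * p) setT S.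
have BA G : ~~ B (edges G) -> (clique_chromatic G <= K * k)%N.
  rewrite negb_or negbK => /andP[nlon col].
  exact: (clique_chromatic_lonely k0 col).
apply: le_trans (Gnp_prob_ge p01 BA); rewrite lerD2l lerN2.
apply: le_trans (Pr_or_le (edge_prob01 p01) _ _) _.
rewrite mulrDr; apply: lerD.
  have := @Pr_lonely_star R 'I_n p p01 k; rewrite card_ord; exact.
(* The relation is empty, hence d = 0; x = 1 is just some positive value. *)
have := @greedy R 'I_n K D p s 1 0 _ p0 p2 s0 ltr01 setT K0.
rewrite cardsT card_ord mulr0; apply => //.
by move=> v _; rewrite (_ : _ :&: _ = set0) ?cards0 //; apply/setP => u; rewrite !inE.
Qed.

End GnpBounds.

(** * Choice of the parameters in the two ranges *)

Section Numerics.
Variable R : realType.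
Implicit Types (x y a l : R).

Lemma sqr_le_expR y : 0 <= y -> (1 + y / 2) ^+ 2 <= expR y.
Proof.
move=> y0; rewrite -[y in leRHS](@divfK _ 2) // expRM_natr.
apply: lerXn2r; rewrite ?nnegrE ?expR_ge0 ?expR_ge1Dx //; lra.
Qed.

(** Used with a = ln (ln n), to make ln n dominate ln (ln n). The threshold comes from (1 + a/2)^2
    >= 20 a, true once a >= 76. *)
Lemma large_log a : 80 <= a -> 20 * a <= expR a.
Proof.
move=> ha; apply: le_trans (sqr_le_expR _); last by lra.
nra.
Qed.

Lemma le_truncnS y : y <= (Num.truncn y).+1%:R.
Proof. by apply/ltW/truncnS_gt. Qed.

Lemma truncnS_le_add1 y : 0 <= y -> (Num.truncn y).+1%:R <= y + 1.
Proof. by move=> y0; rewrite -natr1 lerD2r truncn_le. Qed.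

Lemma expRN1_le : expR (- 1) <= 1 / 2 :> R.
Proof.
have h1 := expR_ge1Dx (1 : R); have h0 := expR_gt0 (- 1 : R).
have : expR (- 1) * expR 1 = 1 :> R by rewrite -expRD addNr expR0.
nra.
Qed.

Lemma le_Gnp_prob n (p : R) (A B : pred (sgraph 'I_n)) : 0 <= p <= 1 ->
  (forall G, A G -> B G) -> Gnp_prob p A <= Gnp_prob p B.
Proof.
move=> p01 AB; rewrite /Gnp_prob [leLHS]big_mkcond [leRHS]big_mkcond /=.
apply: ler_sum => G _; have := AB G; case: (A G) => [->//|_].
by case: (B G) => //; rewrite Gnp_mass_wt (wt_ge0 (edge_prob01 p01)).
Qed.

End Numerics.

(* Logarithmic coordinates: [l = ln n], [a = ln (ln n)], [P = ln p], [tau = n p^2]. *)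
Lemma dense_range_bound (R : realType) n (P l a : R) (tau := expR (l + 2 * P))
    (xi0 := 2 * tau - (l + a)) :
    n%:R = expR l -> l = expR a -> 80 <= a -> l / 2 + a <= tau -> tau <= 3 * l ->
  1 - 2 * expR (- l) <=
  Gnp_prob (expR P) (fun G : sgraph 'I_n =>
    (clique_chromatic G)%:R <= 520 * expR (3 / 2 * P + l - a / 2) * (l / xi0)).
Proof.
move=> nE lE a_large tau_ge tau_le.
have tau_def : tau = expR (l + 2 * P) by [].
have xi_def : xi0 = 2 * tau - (l + a) by [].
clearbody xi0; clearbody tau.
have l_large : 20 * a <= l.
  by rewrite lE large_log.
have l_gt0 : 0 < l.
  by rewrite lE expR_gt0.
have P_ge : a - 1 <= l + 2 * P.
  rewrite -ler_expR -tau_def; apply: le_trans tau_ge.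
  apply: le_trans (_ : l * (1 / 2) <= _); last by lra.
  by rewrite expRD -lE; apply: ler_wpM2l (@expRN1_le R); exact: ltW.
have P_le : l + 2 * P <= a + 2.
  rewrite -ler_expR -tau_def; apply: le_trans tau_le _.
  rewrite expRD -lE mulrC; apply: ler_wpM2l; first exact: ltW.
  by apply: le_trans (expR_ge1Dx _); lra.
have xi_ge : a <= xi0.
  rewrite xi_def; lra.
have xi_le : xi0 <= 5 * l.
  rewrite xi_def; lra.
(* This is p^(-3/2) sqrt(ln n) / 8, so that 4 s^2 p^3 = l/16. *)
pose s := 1 / 8 * expR (- (3 / 2 * P) + a / 2).
have ns : n%:R / s = 8 * expR (3 / 2 * P + l - a / 2).
  rewrite /s nE invfM -expRN mul1r invrK mulrCA -expRD; congr (_ * expR _); ring.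
have s_gt0 : 0 < s.
  by rewrite /s mulr_gt0 ?expR_gt0 //; lra.
pose K := (Num.truncn (4 * n%:R / s)).+1.
have K_ge : 32 * expR (3 / 2 * P + l - a / 2) <= K%:R.
  apply: le_trans (le_truncnS _); rewrite -[4 * _ / _]mulrA ns; lra.
have Ks : 4 * n%:R <= K%:R * s by rewrite -ler_pdivrMr //; exact: le_truncnS.
have K_le : K%:R <= 4 * n%:R / s + 1.
  by apply: truncnS_le_add1; rewrite divr_ge0 ?mulr_ge0 // ltW.
have K_gt0 : (0 < K)%N by [].
clearbody K.
(* A lonely star has probability at most exp(l - k xi/4), which is at most 1/n when k xi >= 8 l. *)
pose k := (Num.truncn (8 * l / xi0)).+1.
have k_le : k%:R <= 13 * (l / xi0).
  have xi_gt0 : 0 < xi0 by lra.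
  apply: le_trans (truncnS_le_add1 _) _; first by rewrite divr_ge0 ?mulr_ge0 //; lra.
  have : xi0 / xi0 <= 5 * l / xi0 by rewrite ler_wpM2r ?invr_ge0 // ltW.
  by rewrite divff ?gt_eqF //; lra.
have k_ge : 8 * l <= k%:R * xi0.
  have xi_gt0 : 0 < xi0 by lra.
  rewrite -ler_pdivrMr //; exact: le_truncnS.
have k_le_l : k%:R <= l - 1.
  have xi_gt0 : 0 < xi0 by lra.
  apply: le_trans (truncnS_le_add1 _) _; first by rewrite divr_ge0 ?mulr_ge0 //; lra.
  have : 8 * l / xi0 <= l / 2; last by lra.
  rewrite ler_pdivrMr //; nra.
have k_gt0 : (0 < k)%N by [].
clearbody k.
have p_le : expR P * l ^+ 3 <= 1.
  by rewrite lE -expRM_natr -expRD -[leRHS]expR0 ler_expR; have := P_le; lra.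
have p_le_half : expR P <= 1 / 2.
  by apply: le_trans (@expRN1_le R); rewrite ler_expR; have := P_le; lra.
have k_lt_n : (k < n)%N.
  by rewrite -(ltr_nat R) nE; have := expR_ge1Dx l; have := k_le_l; lra.
have lonely_small : n%:R * ((n%:R * expR P) ^+ k *
      expR (- (expR P ^+ 2 * k%:R * (1 - expR P * k%:R / 2))) ^+ (n - k.+1))
  <= expR (- l).
  rewrite -!expRM_natr {1 2}nE -expRD -expRM_natr -!expRD ler_expR.
  rewrite natrB // -[k.+1%:R]natr1 [expR (P * 2)]expRM_natr.
  have tauE : expR P ^+ 2 * n%:R = tau.
    by rewrite nE -expRM_natr -expRD tau_def; congr expR; ring.
  have kl := k_le_l; have kx := k_ge; have pl := p_le; have u0 := expR_gt0 P.
  have k0 : 0 <= k%:R :> R by rewrite ler0n.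
  move: tauE kl kx pl u0 k0 p_le_half.
  move: (expR P) (k%:R) (n%:R) => u kk nn tauE kl kx pl u0 k0 uh.
  clear - tauE kl kx pl u0 k0 uh P_le xi_ge xi_def l_large a_large tau_ge tau_le.
  have l1 : 3 <= l by lra.
  have ll : 9 <= l * l by nra.
  have h1 : tau * (u * kk) <= 1.
    apply: le_trans pl; rewrite mulrCA ler_pM2l // exprS expr2.
    apply: le_trans (_ : (3 * l) * l <= _); last by nra.
    by apply: ler_pM => //; lra.
  have h2 : u ^+ 2 * (kk + 1) <= 1.
    apply: le_trans pl; rewrite expr2 -mulrA ler_pM2l // exprS expr2.
    apply: le_trans (_ : 1 * l <= _); last by nra.
    by apply: ler_pM; lra.
  (* Of the loss 3/2, the k + 1 excluded vertices account for 1 and the second-order correction for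
     1/2. *)
  have h3 : kk * (tau - 3 / 2) <= u ^+ 2 * kk * (1 - u * kk / 2) * (nn - (kk + 1)).
    rewrite (_ : u ^+ 2 * kk * (1 - u * kk / 2) * (nn - (kk + 1)) =
      kk * (u ^+ 2 * nn - u ^+ 2 * (kk + 1) - u ^+ 2 * nn * (u * kk) / 2
             + u ^+ 2 * (kk + 1) * (u * kk) / 2)); last by ring.
    rewrite tauE; apply: ler_wpM2l => //.
    have : 0 <= u ^+ 2 * (kk + 1) * (u * kk) / 2.
      have u0' := ltW u0.
      by rewrite divr_ge0 // mulr_ge0 // mulr_ge0 ?exprn_ge0 //; lra.
    lra.
  (* The upper bound on [P] gives l + P - tau <= 1 - xi/2; since xi >= a >= 80, half of xi/2 absorbs
     the constants. *)
  have h4 : kk * (l + P - tau + 3 / 2) <= kk * (- xi0 / 4).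
    apply: ler_wpM2l => //; have := P_le; have := xi_ge; rewrite xi_def; lra.
  lra.
have join_small : n%:R * expR (- (join_prob (expR P) s 1 * K%:R / 2)) <= expR (- l).
  clear - nE lE K_ge p_le_half P_ge l_large a_large.
  rewrite [X in X * _]nE -expRD ler_expR; suff : 2 * l <= join_prob (expR P) s 1 * K%:R / 2 by lra.
  have jp : expR (- 1 - l / 16) / 2 <= join_prob (expR P) s 1.
    rewrite /join_prob ler_wpM2r // ler_expR.
    have -> : 4 * s ^+ 2 * expR P ^+ 3 = l / 16.
      have -> : 4 * s ^+ 2 * expR P ^+ 3 =
          (expR (- (3 / 2 * P) + a / 2) ^+ 2 * expR P ^+ 3) / 16 by rewrite /s; field.
      rewrite -!expRM_natr -expRD [X in _ = X / _]lE; congr (expR _ / _); lra.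
    by have := p_le_half; lra.
  have := ler_pM _ _ jp K_ge; rewrite !mulr_ge0 ?expR_ge0 // => /(_ isT isT).
  have : l <= expR (- 1 - l / 16) * expR (3 / 2 * P + l - a / 2).
    by rewrite -expRD {1}lE ler_expR; have := P_ge; lra.
  lra.
have p01 : 0 <= expR P <= 1 by rewrite expR_ge0 /=; have := p_le_half; lra.
have := Gnp_lonely (expR_gt0 P) p_le_half s_gt0 K_gt0 k_gt0 k_lt_n Ks.
have h1 := lonely_small; have h2 := join_small; rewrite mulrDr => h.
apply: le_trans (le_trans h _).
  by lra.
apply: le_Gnp_prob => // G; rewrite -(ler_nat R) natrM => /le_trans; apply.
(* With E the exponential here, K <= 32 E + 1 <= 40 E and k <= 8 l/xi + 1 <= 13 l/xi. *)
have -> : 520 * expR (3 / 2 * P + l - a / 2) * (l / xi0) =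
  (40 * expR (3 / 2 * P + l - a / 2)) * (13 * (l / xi0)) by ring.
apply: ler_pM => //.
apply: le_trans K_le _.
rewrite -mulrA ns.
have : 1 <= expR (3 / 2 * P + l - a / 2); last by lra.
rewrite -[leLHS]expR0 ler_expR; have := P_ge; lra.
Qed.

(** Within a residue class a vertex is determined by its quotient. *)
Lemma card_residue n L (j : 'I_L.+1) :
  (#|[set v : 'I_n | (inord (v %% L.+1) : 'I_L.+1) == j]| <= (n %/ L.+1).+1)%N.
Proof.
set U := [set v | _].
pose g (v : 'I_n) : 'I_(n %/ L.+1).+1 := inord (v %/ L.+1).
have ginj : {in U &, injective g}.
  move=> v w; rewrite !inE => /eqP vj /eqP wj /(congr1 val) /=.
  rewrite !inordK ?ltnS ?leq_div2r ?(ltnW (ltn_ord _)) // => dvw.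
  have /(congr1 val) := etrans vj (esym wj).
  rewrite /= !inordK ?ltn_pmod // => mvw.
  by apply: val_inj; rewrite /= (divn_eq v L.+1) (divn_eq w L.+1) dvw mvw.
by rewrite -(card_in_imset ginj) -[leqRHS]card_ord max_card.
Qed.

(* Logarithmic coordinates as in [dense_range_bound], with moreover [G = ln Gamma];
   the main factor of the bound in the theorem is
   [n p^(3/2) Gamma / (sqrt (ln n) ln Gamma)]. *)
Lemma sparse_range_bound (R : realType) n (P l a G : R) (tau := expR (l + 2 * P)) :
    n%:R = expR l -> l = expR a -> 80 <= a ->
    a - 2 / 3 * l <= P -> P <= - (1 / 3 * l) - a ->
    a <= G -> - tau - P / 2 + a / 2 <= G ->
  1 - 2 * expR (- l) <=
  Gnp_prob (expR P) (fun H : sgraph 'I_n =>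
    (clique_chromatic H)%:R <=
      9 * (expR 10 * expR (l + 3 / 2 * P - a / 2 + G) / G)).
Proof.
move=> nE lE a_large P_ge P_le aG tG.
have l_large : 20 * a <= l by rewrite lE large_log.
have l_gt0 : 0 < l by lra.
have G0 : 0 < G by lra.
(* With Gamma = exp(G) this is exp(-10) p^(-3/2) sqrt(ln n) G / Gamma; then p s exp(-tau) is a small
   multiple of G by the hypothesis [tG]. *)
pose s := expR (- 10) * expR (- (3 / 2 * P) + a / 2 - G) * G.
have s0 : 0 < s by rewrite /s !mulr_gt0 ?expR_gt0.
pose N := expR 10 * expR (l + 3 / 2 * P - a / 2 + G) / G.
have ns : n%:R / s = N.
  suff -> : n%:R = N * s by rewrite mulfK // gt_eqF.
  rewrite (_ : N * s = expR 10 * expR (- 10) *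
    (expR (l + 3 / 2 * P - a / 2 + G) * expR (- (3 / 2 * P) + a / 2 - G))).
    by rewrite -!expRD nE; congr expR; ring.
  by rewrite /N /s; field; rewrite gt_eqF.
(* This provides enough classes in the end. If P >= -l/2 then l + 3P/2 >= l/4 suffices; otherwise
   tau <= 1 and [tG] makes G large. *)
have key : 5 / 2 * a <= l + 3 / 2 * P + G / 2.
  have [Pl|Pl] := leP (- (l / 2)) P; first by lra.
  have : tau <= 1 by rewrite /tau -[leRHS]expR0 ler_expR; lra.
  lra.
have e10 : 11 <= expR 10 :> R by apply: le_trans (expR_ge1Dx _); lra.
have Nlow : expR 10 / 4 * expR (l + 3 / 2 * P - a / 2 + 3 / 4 * G) <= N.
  have eG : expR (l + 3 / 2 * P - a / 2 + G) =
      expR (l + 3 / 2 * P - a / 2 + 3 / 4 * G) * expR (G / 4).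
    by rewrite -expRD; congr expR; field.
  rewrite /N eG ler_pdivlMr //.
  have h1 := expR_ge1Dx (G / 4).
  have := expR_ge0 (l + 3 / 2 * P - a / 2 + 3 / 4 * G).
  move: (expR (G / 4)) h1 (expR _) (expR 10) e10 => C C1 B X X1 B0.
  have XB : 0 <= X * B by rewrite mulr_ge0 //; lra.
  have : 0 <= X * B * (C - G / 4) by rewrite mulr_ge0 //; lra.
  by lra.
have p_half : expR P <= 1 / 2.
  by apply: le_trans (@expRN1_le R); rewrite ler_expR; lra.
have tauE : expR P ^+ 2 * n%:R = tau.
  by rewrite nE -expRM_natr -expRD /tau; congr expR; ring.
have tau0 : 0 < tau by exact: expR_gt0.
(* The quantity is n p^3 ln n; the upper limit n^(-1/3) / ln n on p is used here to control the
   second-order term for k of order ln n. *)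
have tul : tau * (expR P * l) <= 1 / 2.
  rewrite (_ : tau * _ = expR (l + 2 * P + P + a)).
    by apply: le_trans (@expRN1_le R); rewrite ler_expR; lra.
  by rewrite /tau [X in _ * X = _]mulrC {2}lE -!expRD; congr expR; ring.
have e4 : expR (- 4) <= 1 / 16 :> R.
  rewrite (_ : -4 = (-1) * 4) ?expRM_natr; last by ring.
  have h := @expRN1_le R; have h0 := expR_ge0 (-1 : R).
  rewrite (_ : 1 / 16 = (1 / 2) ^+ 4 :> R); last by field.
  by apply: lerXn2r; rewrite ?nnegrE //; lra.
have ul : 48 * (expR P * l) <= 1.
  apply: le_trans (_ : expR P * l * l <= _).
    have : 0 <= expR P * l * (l - 48); last by lra.
    by rewrite !mulr_ge0 ?expR_ge0 //; lra.
  by rewrite {1 2}lE -!expRD -[leRHS]expR0 ler_expR; lra.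
have us : expR P * (s * expR (6 - tau)) <= G / 8.
  have -> : expR P * (s * expR (6 - tau)) =
      expR (- 4) * expR (- tau - P / 2 + a / 2 - G) * G.
    rewrite (_ : expR P * (s * expR (6 - tau)) = expR P * expR (- 10) *
      expR (- (3 / 2 * P) + a / 2 - G) * expR (6 - tau) * G); last by rewrite /s; ring.
    by rewrite -!expRD; congr (expR _ * _); field.
  have h1 : expR (- tau - P / 2 + a / 2 - G) <= 1.
    by rewrite -[leRHS]expR0 ler_expR; lra.
  have h2 : expR (- 4) * expR (- tau - P / 2 + a / 2 - G) <= 1 / 16 * 1.
    by rewrite ler_pM ?expR_ge0.
  have := ler_wpM2r (ltW G0) h2; lra.
(* With classes this small, the triangle obstacles cost only a constant factor. *)
have s2 : 4 * s ^+ 2 * expR P ^+ 3 <= 1.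
  rewrite (_ : 4 * s ^+ 2 * expR P ^+ 3 =
      4 * expR (- 20) * (expR (a - 2 * G) * G ^+ 2)); last first.
    rewrite (_ : 4 * s ^+ 2 * expR P ^+ 3 = 4 * (expR (- 10) ^+ 2) *
      (expR (- (3 / 2 * P) + a / 2 - G) ^+ 2 * expR P ^+ 3 * G ^+ 2)); last first.
      by rewrite /s; ring.
    by rewrite -!expRM_natr -!expRD; congr (_ * expR _ * (expR _ * _)); field.
  have h1 : expR (- 20) <= 1 / 16 :> R by apply: le_trans e4; rewrite ler_expR; lra.
  have h2 : expR (a - 2 * G) * G ^+ 2 <= 4.
    apply: le_trans (_ : expR (- G) * G ^+ 2 <= _).
      by rewrite ler_wpM2r ?exprn_ge0 ?(ltW G0) // ler_expR; lra.
    rewrite -(ler_pM2l (expR_gt0 G)) mulrA -expRD subrr expR0 mul1r.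
    by have := @sqr_le_expR R G (ltW G0); rewrite !expr2; nra.
  have h3 : 0 <= expR (a - 2 * G) * G ^+ 2 by rewrite mulr_ge0 ?expR_ge0 ?exprn_ge0 ?ltW.
  have := ler_pM (expR_ge0 _) h3 h1 h2; lra.
have NE : N = expR 10 * expR (l + 3 / 2 * P - a / 2 + G) / G by [].
clearbody s N tau.
pose L' := Num.truncn l.
have L_ge : l <= L'.+1%:R by exact: le_truncnS.
have L_le : L'.+1%:R <= l + 1 by apply: truncnS_le_add1; lra.
clearbody L'.
have n_large : 2 * l <= n%:R.
  rewrite nE; apply: le_trans (sqr_le_expR _); last by lra.
  have : 0 <= l * (l - 8) by rewrite mulr_ge0 //; lra.
  by rewrite expr2; lra.
have L_le_N : L'.+1%:R <= N.
  apply: le_trans Nlow; have : l <= expR (l + 3 / 2 * P - a / 2 + 3 / 4 * G).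
    by rewrite {1}lE ler_expR; lra.
  by have := e10; nra.
pose m : R := n%:R / L'.+1%:R + 1.
have L0 : 0 < L'.+1%:R :> R by lra.
have mL : L'.+1%:R * m = n%:R + L'.+1%:R by rewrite /m; field; rewrite gt_eqF.
have m_le_n : m <= n%:R.
  rewrite -(ler_pM2l L0) mL.
  have : 0 <= (L'.+1%:R - 2) * n%:R :> R by rewrite mulr_ge0 //; lra.
  by lra.
have m0 : 0 < m by rewrite -(pmulr_rgt0 _ L0) mL; lra.
pose k := (Num.truncn (3 * l)).+1.
have k_ge : 3 * l <= k%:R by exact: le_truncnS.
have k_le : k%:R <= 3 * l + 1 by apply: truncnS_le_add1; lra.
clearbody k.
have tuk : tau * (expR P * k%:R) <= 2.
  have : expR P * k%:R <= expR P * (4 * l) by rewrite ler_wpM2l ?expR_ge0 //; lra.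
  by move/(ler_wpM2l (ltW tau0)); lra.
(* Ignoring common neighbors inside a part costs about tau/l in the exponent. This is bounded while
   tau <= 2l; for larger tau the term exp(-l) takes over. *)
pose Q : R := expR (5 - tau) + expR (- l).
(* The factor e makes [m * Q / t] at most 1/e, so that the degree tail is at most exp(-k). *)
pose t := (Num.truncn (expR 1 * (m * Q))).+1.
have Q0 : 0 < Q by rewrite /Q addr_gt0 ?expR_gt0.
have t_ge : expR 1 * (m * Q) <= t%:R by exact: le_truncnS.
have t_le : t%:R <= expR 1 * (m * Q) + 1.
  by apply: truncnS_le_add1; rewrite mulr_ge0 ?expR_ge0 // mulr_ge0 // ltW.
(* An average class receives (t + k)/K far vertices. The first summand covers the main part of t, as
   4m <= K s; the rest of 4 (t + k) is at most 16 l + 8 <= 24 l. *)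
pose x := s * expR (6 - tau) + 24 * l.
have t0 : (0 < t)%N by [].
clearbody t.
have x0 : 0 < x by rewrite /x addr_gt0 ?mulr_gt0 ?expR_gt0.
pose K := (Num.truncn (4 * m / s)).+1.
have Ks : 4 * m <= K%:R * s by rewrite -ler_pdivrMr //; exact: le_truncnS.
have K_le : K%:R <= 4 * m / s + 1.
  by apply: truncnS_le_add1; rewrite divr_ge0 ?mulr_ge0 // ltW.
have K0 : (0 < K)%N by [].
clearbody K.
have K1 : 1 <= K%:R :> R by rewrite ler1n.
have Kx : 4 * (t + k)%:R <= K%:R * x.
  clear - t_le m0 m_le_n nE lE l_large a_large Ks K1 k_le s0 l_gt0.
  have h1 : expR 1 * (m * Q) <= m * expR (6 - tau) + l.
    rewrite /Q mulrDr mulrDr; apply: lerD.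
      rewrite mulrCA -expRD le_eqVlt; apply/orP; left; apply/eqP.
      by congr (_ * expR _); ring.
    apply: le_trans (_ : expR 1 * 1 <= _); last first.
      by rewrite mulr1 lE ler_expR; lra.
    rewrite ler_wpM2l ?expR_ge0 // -(@expRxMexpNx_1 _ l).
    by rewrite -nE ler_wpM2r ?expR_ge0.
  have h2 : 4 * m * expR (6 - tau) <= K%:R * s * expR (6 - tau).
    by rewrite ler_wpM2r ?expR_ge0.
  have h3 : 24 * l <= K%:R * (24 * l) by rewrite ler_peMl //; lra.
  by rewrite natrD /x; lra.
have part_le j : #|[set v : 'I_n | (inord (v %% L'.+1) : 'I_L'.+1) == j]|%:R <= m.
  apply: le_trans (_ : (n %/ L'.+1).+1%:R <= _); first by rewrite ler_nat card_residue.
  by rewrite -natr1 /m lerD2r ler_pdivlMr // -natrM ler_nat leq_trunc_div.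
have Q_ge j : expR (- (expR P ^+ 2 * (1 - expR P * k%:R / 2)))
    ^+ (n - #|[set v : 'I_n | (inord (v %% L'.+1) : 'I_L'.+1) == j]|) <= Q.
  clear - tauE tau0 tuk part_le L_ge l_large a_large l_gt0 L0 p_half.
  have := part_le j; set c := #|_| => cm.
  have cn : (c <= n)%N by rewrite -[leqRHS]card_ord max_card.
  rewrite -expRM_natr natrB //.
  have u0 := expR_gt0 P; have k0 : 0 <= k%:R :> R by rewrite ler0n.
  have c0 : 0 <= c%:R :> R by rewrite ler0n.
  have h1 : expR P ^+ 2 * m <= tau / l + 1.
    rewrite /m mulrDr mulrA tauE mulr1; apply: lerD.
      by rewrite ler_wpM2l ?(ltW tau0) // lef_pV2 ?posrE.
    by rewrite expr2; nra.
  have h2 : expR P ^+ 2 * c%:R <= expR P ^+ 2 * m.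
    by apply: ler_wpM2l => //; rewrite exprn_ge0 // ltW.
  have h3 : 0 <= expR P ^+ 2 * (expR P * k%:R) * c%:R.
    by rewrite !mulr_ge0 ?exprn_ge0 ?expR_ge0.
  have h4 : - (expR P ^+ 2 * (1 - expR P * k%:R / 2)) * (n%:R - c%:R)
      <= - tau + tau / l + 2.
    rewrite (_ : - (expR P ^+ 2 * (1 - expR P * k%:R / 2)) * (n%:R - c%:R) =
      - (expR P ^+ 2 * n%:R) + expR P ^+ 2 * n%:R * (expR P * k%:R) / 2
      + expR P ^+ 2 * c%:R - expR P ^+ 2 * (expR P * k%:R) * c%:R / 2); last by field.
    by rewrite tauE; lra.
  rewrite /Q; have [tl|tl] := leP tau (2 * l).
    apply: le_trans (_ : expR (5 - tau) <= _); last by rewrite lerDl expR_ge0.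
    have : tau / l <= 2 by rewrite ler_pdivrMr.
    by rewrite ler_expR; lra.
  apply: le_trans (_ : expR (- l) <= _); last by rewrite lerDr expR_ge0.
  have : tau / l <= tau / 4 by rewrite ler_wpM2l ?(ltW tau0) // lef_pV2 ?posrE //; lra.
  by rewrite ler_expR; lra.
have fail1 : n%:R * (m * Q / t%:R) ^+ k <= expR (- l).
  clear - nE t0 t_ge k_ge l_gt0 m0 Q0.
  have {}t0 : 0 < t%:R :> R by rewrite ltr0n.
  apply: le_trans (_ : expR l * expR (- 1) ^+ k <= _); last first.
    by rewrite -expRM_natr -expRD ler_expR; lra.
  rewrite nE ler_wpM2l ?expR_ge0 //; apply: lerXn2r; rewrite ?nnegrE ?expR_ge0 //.
    by rewrite !mulr_ge0 ?invr_ge0 ?ltW.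
  rewrite ler_pdivrMr // -(ler_pM2l (expR_gt0 1)) [leRHS]mulrA -expRD subrr expR0 mul1r.
  exact: t_ge.
(* The two summands of 2px are at most G/4 and 1, and the triangle term is at most 1. *)
have join_ge : expR (- (G / 4) - 2) / 2 <= join_prob (expR P) s x.
  clear - us ul s2.
  rewrite /join_prob ler_wpM2r // ler_expR.
  by rewrite /x; lra.
have fail2 : n%:R * expR (- (join_prob (expR P) s x * K%:R / 2)) <= expR (- l).
  clear - nE lE l_gt0 l_large a_large L_ge L_le L0 Ks s0 ns Nlow e10 join_ge key aG L_le_N.
  rewrite [X in X * _]nE -expRD ler_expR.
  suff : 2 * l <= join_prob (expR P) s x * K%:R / 2 by lra.
  have K_ge : 4 * (N / L'.+1%:R) <= K%:R.
    rewrite (_ : 4 * (N / _) = 4 * (n%:R / L'.+1%:R) / s); last by rewrite -ns; ring.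
    by rewrite ler_pdivrMr //; apply: le_trans Ks; rewrite ler_wpM2l // /m lerDl.
  have NL : N / (2 * l) <= N / L'.+1%:R.
    have N0 : 0 <= N by lra.
    by rewrite ler_wpM2l // lef_pV2 ?posrE //; lra.
  have Nl : expR 10 / 8 * (expR (l + 3 / 2 * P - a / 2 + 3 / 4 * G) / l) <= N / (2 * l).
    rewrite (_ : expR 10 / 8 * _ =
      expR 10 / 4 * expR (l + 3 / 2 * P - a / 2 + 3 / 4 * G) / (2 * l)); last first.
      by field; rewrite gt_eqF.
    by rewrite ler_wpM2r // invr_ge0; lra.
  have h0 : 0 <= 4 * (expR 10 / 8 * (expR (l + 3 / 2 * P - a / 2 + 3 / 4 * G) / l)).
    by rewrite !mulr_ge0 ?expR_ge0 ?invr_ge0 // ltW.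
  have h1 : 4 * (expR 10 / 8 * (expR (l + 3 / 2 * P - a / 2 + 3 / 4 * G) / l)) <= K%:R.
    by apply: le_trans K_ge; rewrite ler_wpM2l //; apply: le_trans Nl NL.
  have h2 : 0 <= expR (- (G / 4) - 2) / 2 by rewrite mulr_ge0 ?expR_ge0.
  have := ler_pM h2 h0 join_ge h1.
  rewrite (_ : expR (- (G / 4) - 2) / 2 * _ = expR (- (G / 4) - 2) * expR 10
     * expR (l + 3 / 2 * P - a / 2 + 3 / 4 * G) / l / 4); last by field; rewrite gt_eqF.
  rewrite -!expRD.
  set E := expR _; suff : 16 * l ^+ 2 <= E.
    move=> hE h; have : 16 * l <= E / l by rewrite ler_pdivlMr // -mulrA -expr2.
    by lra.
  apply: le_trans (_ : expR (8 + 2 * a) <= _); last by rewrite ler_expR; lra.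
  rewrite expRD (_ : 2 * a = a * 2); last by ring.
  rewrite expRM_natr -lE ler_wpM2r ?exprn_ge0 ?(ltW l_gt0) //.
  by apply: le_trans (sqr_le_expR _) => //; lra.
have := Gnp_parts (expR_gt0 P) p_half s0 x0 K0 t0 part_le Q_ge Ks Kx.
rewrite mulrDr => h; apply: le_trans (le_trans h _); first by lra.
have p01 : 0 <= expR P <= 1 by rewrite expR_ge0 /=; lra.
apply: le_Gnp_prob => // H; rewrite -(ler_nat R) natrM => /le_trans; apply.
(* The constant 9 is 8 + 1: the parts have total size bound n + L <= 2n, giving 8N, and rounding up
   K costs L <= N. *)
rewrite -NE; apply: le_trans (_ : L'.+1%:R * (4 * m / s + 1) <= _).
  by rewrite ler_wpM2l // ltW.
rewrite (_ : L'.+1%:R * _ = 4 * ((L'.+1%:R * m) / s) + L'.+1%:R); last by ring.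
have : L'.+1%:R * m / s <= 2 * N; last by lra.
rewrite -ns mulrA ler_wpM2r ?invr_ge0 ?(ltW s0) // mL; lra.
Qed.

Local Open Scope classical_set_scope.
Local Open Scope ring_scope.

(** * Passage to the limit *)

Section Asymptotics.
Variable R : realType.

Lemma near_lnln (A : R) : \forall n \near \oo, A <= ln (ln (n%:R : R)).
Proof.
exists (Num.truncn (expR (expR A))).+1 => // n /= hn.
have h1 : expR (expR A) <= n%:R.
  by apply: le_trans (le_truncnS _) _; rewrite ler_nat.
have n0 : 0 < n%:R :> R by apply: lt_le_trans h1; exact: expR_gt0.
have h2 : expR A <= ln n%:R by rewrite -ler_expR lnK.
by rewrite -ler_expR lnK // posrE; apply: lt_le_trans h2; exact: expR_gt0.
Qed.

(** As [ln] takes the value 0 at nonpositive arguments, a positive double logarithm forces both n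
    and ln n to be positive. *)
Lemma lnln_gt0 n : 0 < ln (ln (n%:R : R)) ->
  n%:R = expR (ln n%:R) :> R /\ ln n%:R = expR (ln (ln n%:R)) :> R.
Proof.
move=> a0; have l0 : 0 < ln n%:R :> R.
  by rewrite ltNge; apply: contraTN a0 => /ln0 ->; rewrite ltxx.
split; rewrite lnK // posrE ltNge.
by apply: contraTN l0 => /ln0 ->; rewrite ltxx.
Qed.

Lemma powRE (x r : R) : 0 < x -> x `^ r = expR (r * ln x).
Proof. by move=> x0; rewrite /powR gt_eqF. Qed.

Lemma sqrt_expR (x : R) : Num.sqrt (expR x) = expR (x / 2).
Proof.
rewrite -[X in expR X](@divfK _ 2) // expRM_natr sqrtr_sqr.
by rewrite ger0_norm ?expR_ge0.
Qed.

Lemma whp_of_bound (p : nat -> R) (A : forall n, pred (sgraph 'I_n)) :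
  (\forall n \near \oo, 0 <= p n <= 1 /\
     1 - 2 * expR (- ln n%:R) <= Gnp_prob (p n) (A n)) -> whp p A.
Proof.
move=> bound; apply/cvgrPdist_le => e e0; near=> n.
have [p01 h] : 0 <= p n <= 1 /\ 1 - 2 * expR (- ln n%:R) <= Gnp_prob (p n) (A n).
  by near: n.
have ha : 2 / e <= ln (ln (n%:R : R)) by near: n; exact: near_lnln.
have a0 : 0 < ln (ln (n%:R : R)) by apply: lt_le_trans ha; rewrite divr_gt0.
have [_ lE] := lnln_gt0 a0.
rewrite ger0_norm ?subr_ge0 ?Gnp_prob_le1 //.
apply: le_trans (_ : 2 * expR (- ln n%:R) <= _); first by lra.
rewrite expRN ler_pdivrMr ?expR_gt0 // mulrC -ler_pdivrMr //.
apply: le_trans (expR_ge1Dx _); rewrite lE.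
by have := expR_ge1Dx (ln (ln (n%:R : R))); lra.
Unshelve. all: by end_near. Qed.

Lemma GammaE (p : nat -> R) n (P l a : R) :
    p n = expR P -> n%:R = expR l -> l = expR a -> ln n%:R = l ->
  Gamma p n = expR (Num.max (- expR (l + 2 * P) - P / 2 + a / 2) a).
Proof.
move=> pE nE lE lnE; rewrite /Gamma lnE pE powRE ?expR_gt0 // expRK.
have -> : n%:R * expR P ^+ 2 = expR (l + 2 * P) :> R.
  by rewrite nE -expRM_natr -expRD; congr expR; ring.
transitivity (Num.max (expR (- expR (l + 2 * P) - P / 2 + a / 2)) (expR a)).
  rewrite [in Num.sqrt _]lE sqrt_expR -!expRD -lE; congr (Num.max (expR _) _); ring.
move: (_ + a / 2) => u.
by case: (leP u a) => ua; [apply/max_idPr|apply/max_idPl]; rewrite ler_expR // ltW.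
Qed.

End Asymptotics.

Theorem theorem4 (R : realType) :
  exists C1 C2 : R, [/\ 0 < C1, 0 < C2,
    (forall p : nat -> R,
      (\forall n \near \oo,
         ln n%:R * n%:R `^ (- (2 / 3)) <= p n
         /\ p n <= n%:R `^ (- (1 / 3)) / ln n%:R) ->
      [/\ whp p (fun n G =>
            (clique_chromatic G)%:R <=
              C1 * Num.max (expR (- (n%:R * p n ^+ 2)) * n%:R * p n / ln n%:R)
                           (p n `^ (3 / 2) * n%:R / Num.sqrt (ln n%:R))
                 * (ln n%:R / ln (Gamma p n))),
          \forall n \near \oo, ln (ln n%:R) <= ln (Gamma p n)
        & (fun n => ln (Gamma p n)) =O_\oo (fun n => ln n%:R : R)])
  & (forall p : nat -> R,
      (\forall n \near \oo,
         Num.sqrt ((2^-1 * ln n%:R + ln (ln n%:R)) / n%:R) <= p n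
         /\ p n <= Num.sqrt (3 * ln n%:R / n%:R)) ->
      whp p (fun n G =>
        (clique_chromatic G)%:R <=
          C2 * (p n `^ (3 / 2) * n%:R / Num.sqrt (ln n%:R))
             * (ln n%:R / xi p n))
      /\ \forall n \near \oo, ln (ln n%:R) <= xi p n /\ xi p n < 5 * ln n%:R)].
Proof.
exists (9 * expR 10), 520; split; rewrite ?mulr_gt0 ?expR_gt0 //.
- move=> p hp.
  have key : \forall n \near \oo, exists P l a : R,
      [/\ p n = expR P, n%:R = expR l, l = expR a, ln n%:R = l & 80 <= a] /\
      (a - 2 / 3 * l <= P /\ P <= - (1 / 3 * l) - a).
    near=> n; have a_large : 80 <= ln (ln (n%:R : R)) by near: n; exact: near_lnln.
    have a0 : 0 < ln (ln (n%:R : R)) by lra.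
    have [nE lE] := lnln_gt0 a0.
    have : ln n%:R * n%:R `^ (- (2 / 3)) <= p n
         /\ p n <= n%:R `^ (- (1 / 3)) / ln n%:R by near: n.
    have n0 : 0 < n%:R :> R by rewrite nE expR_gt0.
    rewrite !(powRE _ n0).
    have -> : ln n%:R * expR (- (2 / 3) * ln n%:R) =
        expR (ln (ln n%:R) - 2 / 3 * ln n%:R) :> R.
      by rewrite [X in X * _]lE -expRD; congr expR; ring.
    have -> : expR (- (1 / 3) * ln n%:R) / ln n%:R =
        expR (- (1 / 3 * ln n%:R) - ln (ln n%:R)) :> R.
      rewrite (_ : (ln n%:R)^-1 = expR (- ln (ln n%:R))); last by rewrite expRN -lE.
      by rewrite -expRD; congr expR; ring.
    move=> [p_ge p_le].
    have pE : p n = expR (ln (p n)).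
      by rewrite lnK // posrE; apply: lt_le_trans p_ge; exact: expR_gt0.
    exists (ln (p n)), (ln n%:R), (ln (ln n%:R)); split=> //.
    by split; rewrite -ler_expR -pE.
  have lnG n P l a : p n = expR P -> n%:R = expR l -> l = expR a -> ln n%:R = l ->
      ln (Gamma p n) = Num.max (- expR (l + 2 * P) - P / 2 + a / 2) a.
    by move=> pE nE lE lnE; rewrite (GammaE pE nE lE lnE) expRK.
  have G_ge : \forall n \near \oo, ln (ln n%:R) <= ln (Gamma p n).
    apply: filterS key.
    move=> n [P [l [a [[pE nE lE lnE _] _]]]].
    by rewrite (lnG n P l a) // lnE lE expRK le_max lexx orbT.
  split => //.
  + apply: whp_of_bound; apply: filterS key.
    move=> n [P [l [a [[pE nE lE lnE a_large] [P_ge P_le]]]]].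
    have l_gt0 : 0 < l by rewrite lE expR_gt0.
    have p01 : 0 <= p n <= 1.
      by rewrite pE expR_ge0 -[leRHS]expR0 ler_expR /=; lra.
    split => //; rewrite (lnG n P l a) // lnE pE.
    set G := Num.max _ a.
    have aG : a <= G by rewrite le_max lexx orbT.
    have uG : - expR (l + 2 * P) - P / 2 + a / 2 <= G by rewrite le_max lexx.
    apply: le_trans (sparse_range_bound nE lE a_large P_ge P_le aG uG) _.
    apply: le_Gnp_prob => [|H /le_trans]; first by rewrite -pE.
    apply.
    have -> : expR (- (n%:R * expR P ^+ 2)) * n%:R * expR P / l =
        expR (l + P - expR (l + 2 * P) - a).
      rewrite (_ : n%:R * expR P ^+ 2 = expR (l + 2 * P)); last first.
        by rewrite nE -expRM_natr -expRD; congr expR; ring.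
      rewrite (_ : l^-1 = expR (- a)); last by rewrite expRN -lE.
      by rewrite nE -!expRD; congr expR; ring.
    have -> : expR P `^ (3 / 2) * n%:R / Num.sqrt l = expR (3 / 2 * P + l - a / 2).
      by rewrite powRE ?expR_gt0 // expRK nE [in Num.sqrt _]lE sqrt_expR -expRN -!expRD.
    set M := Num.max (expR (l + P - _ - _)) _.
    (* The maximum in Gamma becomes the maximum M after multiplication by n p^(3/2) (ln n)^(-3/2),
       branch by branch. *)
    have hM : expR (l + 3 / 2 * P - a / 2 + G - a) <= M.
      rewrite le_max !ler_expR /G.
      by case: (leP _ a) => _; apply/orP; [right|left]; lra.
    have G0 : 0 < G by lra.
    rewrite (_ : 9 * (expR 10 * _ / G) =
      9 * expR 10 / G * (expR (l + 3 / 2 * P - a / 2 + G - a) * l)); last first.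
      by rewrite [X in _ * X = _]mulrAC [X in _ = _ * (_ * X)]lE -expRD subrK; ring.
    rewrite -/M (_ : 9 * expR 10 * M * (l / G) = 9 * expR 10 / G * (M * l)); last by ring.
    rewrite ler_wpM2l //; first by rewrite !mulr_ge0 ?expR_ge0 ?invr_ge0 // ltW.
    by rewrite ler_wpM2r // ltW.
  + apply/eqO_exP; exists 1 => //; apply: filterS key.
    move=> n [P [l [a [[pE nE lE lnE a_large] [P_ge P_le]]]]].
    have al : 20 * a <= l by rewrite lE large_log.
    rewrite (lnG n P l a) // lnE mul1r.
    have G_le : Num.max (- expR (l + 2 * P) - P / 2 + a / 2) a <= l.
      by rewrite ge_max; apply/andP; split; have := expR_gt0 (l + 2 * P); lra.
    rewrite !ger0_norm //; first by lra.
    by rewrite le_max; apply/orP; right; lra.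
- move=> p hp.
  have key : \forall n \near \oo, exists P l a : R,
      [/\ p n = expR P, n%:R = expR l, l = expR a, ln n%:R = l & 80 <= a] /\
      (l / 2 + a <= expR (l + 2 * P) /\ expR (l + 2 * P) <= 3 * l).
    near=> n; have a_large : 80 <= ln (ln (n%:R : R)) by near: n; exact: near_lnln.
    have a0 : 0 < ln (ln (n%:R : R)) by lra.
    have [nE lE] := lnln_gt0 a0.
    have [p_ge p_le] : Num.sqrt ((2^-1 * ln n%:R + ln (ln n%:R)) / n%:R) <= p n
         /\ p n <= Num.sqrt (3 * ln n%:R / n%:R) by near: n.
    have l0 : 0 < ln n%:R :> R by rewrite lE expR_gt0.
    have n0 : 0 < n%:R :> R by rewrite nE expR_gt0.
    have y0 : 0 < (2^-1 * ln n%:R + ln (ln n%:R)) / n%:R :> R.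
      by rewrite divr_gt0 //; lra.
    have p0 : 0 < p n by apply: lt_le_trans p_ge; rewrite sqrtr_gt0.
    have pE : p n = expR (ln (p n)) by rewrite lnK // posrE.
    exists (ln (p n)), (ln n%:R), (ln (ln n%:R)); split=> //.
    have -> : expR (ln n%:R + 2 * ln (p n)) = n%:R * p n ^+ 2.
      by rewrite expRD -nE [2 * _]mulrC expRM_natr -pE.
    split.
      have : (2^-1 * ln n%:R + ln (ln n%:R)) / n%:R <= p n ^+ 2.
        rewrite -[leLHS](@sqr_sqrtr _) ?(ltW y0) //.
        by apply: lerXn2r => //; rewrite nnegrE ?sqrtr_ge0 // ltW.
      by rewrite ler_pdivrMr //; lra.
    have : p n ^+ 2 <= 3 * ln n%:R / n%:R.
      rewrite -[leRHS](@sqr_sqrtr _); last by rewrite divr_ge0 ?mulr_ge0 // ltW.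
      by apply: lerXn2r => //; rewrite nnegrE ?sqrtr_ge0 // ltW.
    by rewrite ler_pdivlMr //; lra.
  have xiE n P l a : p n = expR P -> n%:R = expR l -> l = expR a -> ln n%:R = l ->
      xi p n = 2 * expR (l + 2 * P) - (l + a).
    move=> pE nE lE lnE; rewrite /xi lnE pE {1}nE lE expRK -lE; congr (_ - _).
    by rewrite -mulrA -expRM_natr -expRD; congr (_ * expR _); ring.
  split.
    apply: whp_of_bound; apply: filterS key.
    move=> n [P [l [a [[pE nE lE lnE a_large] [tau_ge tau_le]]]]].
    have p01 : 0 <= p n <= 1.
      (* If p exceeded 1, then tau would be at least n, contradicting tau <= 3 ln n. *)
      rewrite pE expR_ge0 -[leRHS]expR0 ler_expR /= leNgt; apply/negP => P0.
      have l_large : 20 * a <= l by rewrite lE large_log.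
      have : expR l <= expR (l + 2 * P) by rewrite ler_expR; lra.
      have l_ge0 : 0 <= l by lra.
      have := sqr_le_expR l_ge0; rewrite expr2.
      have : 0 <= l * (l - 12) by rewrite mulr_ge0 //; lra.
      by lra.
    split => //; rewrite (xiE n P l a) // lnE pE.
    apply: le_trans (dense_range_bound nE lE a_large tau_ge tau_le) _.
    apply: le_Gnp_prob => [|H]; first by rewrite -pE.
    rewrite powRE ?expR_gt0 // expRK nE [in Num.sqrt _]lE sqrt_expR -expRN -!expRD.
    exact.
  apply: filterS key.
    move=> n [P [l [a [[pE nE lE lnE a_large] [tau_ge tau_le]]]]].
  have al : 20 * a <= l by rewrite lE large_log.
  rewrite (xiE n P l a) // lnE; have -> : ln l = a by rewrite lE expRK.
  by split; lra.
Unshelve. all: by end_near. Qed.
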